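(* Assume GCH. Then: (1) SPL implies CLS; (2) CLS implies wFN; (3) wFN implies SAT; (4) wFN implies Nt; (5) wFN implies HnT. Here the principles are: (SPL) there is a splendid space of cardinality $\aleph_{\omega+1}$; (CLS) there is a family $\mathcal A\subseteq[\aleph_\omega]^\omega$ which is cofinal in $\langle[\aleph_\omega]^\omega,\subseteq\rangle$ and locally small; (wFN) the poset $\langle[\aleph_\omega]^\omega,\subseteq\rangle$ has the weak Freese–Nation property; (SAT) there is a saturated almost disjoint family $\mathcal A\subseteq[\aleph_\omega]^\omega$; (Nt) $\mathrm{Nt}\big((D(2)^{\aleph_\omega})_\delta\big)=\omega_1$; (HnT) there is a permutation group on $\aleph_\omega$ which is $\omega$-homogeneous but not $\omega$-transitive.
   Context: $[S]^\omega$ denotes the family of countably infinite subsets of $S$; $x\subseteq^* y$ means $x\setminus y$ is finite. A regular space $X$ is splendid if it is countably compact, locally countable (every point has a countable open neighbourhood) and $\omega$-fair: $|\overline Y|=\omega$ for every $Y\in[X]^\omega$. A family $\mathcal A\subseteq[\kappa]^\omega$ is locally small if $\{X\cap A:A\in\mathcal A\}$ is countable for every $X\in[\kappa]^\omega$. A poset $\langle P,\le\rangle$ has the weak Freese–Nation property if there is a function $F$ assigning to each $p\in P$ a countable subset $F(p)\subseteq P$ such that for all $p\le q$ in $P$ there is $r\in F(p)\cap F(q)$ with $p\le r\le q$. An almost disjoint family (pairwise intersections finite) $\mathcal A\subseteq[\kappa]^\omega$ is saturated if for every $X\in[\kappa]^\omega$ either there is $A\in\mathcal A$ with $A\subseteq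 X$, or $X\subseteq^*\bigcup\mathcal A'$ for some finite $\mathcal A'\subseteq\mathcal A$. The Noetherian type $\mathrm{Nt}(X)$ of a space $X$ is the least cardinal $\kappa$ such that $X$ has a base $\mathcal B$ with $|\{B'\in\mathcal B: B\subseteq B'\}|<\kappa$ for every $B\in\mathcal B$. $D(2)$ is the two-point discrete space, $D(2)^{\aleph_\omega}$ carries the product topology, and for a space $X$, its $G_\delta$-modification $X_\delta$ is the space on the same set whose topology is generated by all $G_\delta$ subsets of $X$. A permutation group $G$ on an uncountable set $A$ is $\omega$-homogeneous if for all $X,Y\in[A]^\omega$ there is $g\in G$ with $g''X=Y$; it is $\omega$-transitive if for every injective function $f$ with $\mathrm{dom}(f)\cup\mathrm{ran}(f)\in[A]^\omega$ there is $g\in G$ with $f\subseteq g$. *)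

(* Defs.v *)
From mathcomp Require Import all_boot.
From mathcomp Require Import boolp classical_sets functions cardinality.
Set Implicit Arguments. Unset Strict Implicit. Unset Printing Implicit Defensive.
Local Open Scope classical_set_scope.
Local Open Scope card_scope.

Definition card_lt T U (A : set T) (B : set U) := A #<= B /\ ~ (B #<= A).

Definition GCH : Prop :=
  forall (X : Type) (A : set (set X)),
    infinite_set [set: X] -> [set: X] #<= A ->
    A #= [set: X] \/ A #= [set: set X].

Definition is_succ_card T U (A : set T) (B : set U) :=
  card_lt A B /\ forall C : set U, C `<=` B -> C #<= A \/ C #= B.

Definition is_aleph_omega (K : Type) : Prop :=
  exists S : nat -> set K,
    [/\ countable (S 0%N) /\ infinite_set (S 0%N),
        forall n, S n `<=` S n.+1,
        forall n, is_succ_card (S n) (S n.+1)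
      & \bigcup_n S n = [set: K]].

Definition ctinf T (A : set T) := countable A /\ infinite_set A.
Definition almost_sub T (x y : set T) := finite_set (x `\` y).

Definition is_topology T (op : set (set T)) :=
  [/\ op set0, op setT,
      forall U V, op U -> op V -> op (U `&` V)
    & forall F : set (set T), F `<=` op -> op (\bigcup_(U in F) U)].

Definition closure T (op : set (set T)) (Y : set T) : set T :=
  [set x | forall U, op U -> U x -> U `&` Y !=set0].

Definition closed T (op : set (set T)) (C : set T) := op (~` C).

Definition regular_space T (op : set (set T)) :=
  is_topology op /\
  (forall x y : T, x <> y -> exists U, op U /\ U x /\ ~ U y) /\
  (forall (C : set T) x, closed op C -> ~ C x ->
     exists U V, [/\ op U, op V, U x, C `<=` V & U `&` V = set0]).

Definition countably_compact T (op : set (set T)) :=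
  forall F : set (set T), countable F -> F `<=` op -> \bigcup_(U in F) U = setT ->
    exists G : set (set T), [/\ finite_set G, G `<=` F & \bigcup_(U in G) U = setT].

Definition locally_countable T (op : set (set T)) :=
  forall x : T, exists U, [/\ op U, U x & countable U].

Definition omega_fair T (op : set (set T)) :=
  forall Y : set T, ctinf Y -> ctinf (closure op Y).

Definition splendid T (op : set (set T)) :=
  [/\ regular_space op, countably_compact op, locally_countable op & omega_fair op].

Definition generated T (G : set (set T)) : set (set T) :=
  [set U | forall op, is_topology op -> G `<=` op -> op U].

Definition cantor_opens (K : Type) : set (set (K -> bool)) :=
  generated [set U | exists (k : K) (b : bool), U = [set f | f k = b]].

Definition Gdelta T (op : set (set T)) (A : set T) :=
  exists F : set (set T), [/\ countable F, F `<=` op & A = \bigcap_(U in F) U].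
Definition delta_mod T (op : set (set T)) : set (set T) := generated (Gdelta op).

Definition is_base T (op : set (set T)) (B : set (set T)) :=
  B `<=` op /\ forall U x, op U -> U x -> exists b, [/\ B b, b x & b `<=` U].

(* Nt(X) = omega_1: the least cardinal kappa for which there is a base all of
   whose members have < kappa supersets in the base is omega_1, i.e. kappa =
   omega_1 works (countably many supersets) and kappa = omega (hence any
   finite kappa) does not (finitely many supersets). *)
Definition supersets_in T (B : set (set T)) (b : set T) := [set b' | B b' /\ b `<=` b'].
Definition Nt_eq_omega1 T (op : set (set T)) :=
  (exists B, is_base op B /\ forall b, B b -> countable (supersets_in B b)) /\
  ~ (exists B, is_base op B /\ forall b, B b -> finite_set (supersets_in B b)).

Definition SPL (K : Type) : Prop :=
  exists (X : Type) (op : set (set X)), splendid op /\ is_succ_card [set: K] [set: X].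

Definition CLS (K : Type) : Prop :=
  exists A : set (set K),
    [/\ A `<=` @ctinf K,
        (forall X, ctinf X -> exists2 a, A a & X `<=` a)
      & forall X, ctinf X -> countable [set X `&` a | a in A]].

Definition wFN (K : Type) : Prop :=
  exists F : set K -> set (set K),
    (forall p, ctinf p -> F p `<=` @ctinf K /\ countable (F p)) /\
    (forall p q, ctinf p -> ctinf q -> p `<=` q ->
       exists r, [/\ F p r, F q r, p `<=` r & r `<=` q]).

Definition almost_disjoint T (A : set (set T)) :=
  forall a b, A a -> A b -> a <> b -> finite_set (a `&` b).

Definition SAT (K : Type) : Prop :=
  exists A : set (set K),
    [/\ A `<=` @ctinf K, almost_disjoint A &
        forall X, ctinf X ->
          (exists2 a, A a & a `<=` X) \/
          (exists A', [/\ finite_set A', A' `<=` A & almost_sub X (\bigcup_(a in A') a)])].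

Definition Nt (K : Type) : Prop := Nt_eq_omega1 (delta_mod (@cantor_opens K)).

Definition perm_group T (G : set (T -> T)) :=
  [/\ (forall g, G g -> bijective g), G id,
      (forall g h, G g -> G h -> G (g \o h))
    & forall g, G g -> exists2 h, G h & cancel g h /\ cancel h g].

Definition omega_homogeneous T (G : set (T -> T)) :=
  forall X Y : set T, ctinf X -> ctinf Y -> exists2 g, G g & g @` X = Y.

(* an injective function f with domain D is encoded by (D, f) *)
Definition omega_transitive T (G : set (T -> T)) :=
  forall (D : set T) (f : T -> T), {in D &, injective f} -> ctinf (D `|` f @` D) ->
    exists2 g, G g & forall x, D x -> g x = f x.

Definition HnT (K : Type) : Prop :=
  exists G : set (K -> K), [/\ perm_group G, omega_homogeneous G & ~ omega_transitive G].

(* Main.v *)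
(** Parts (2)-(5) rest on a well-order of the reals all of whose initial segments
    are countable, which CH provides.

    (1) In a splendid space countable closed sets are compact, each of them lies in
    a countable clopen set, and a countable compact set has only countably many
    clopen subsets.  Hence the countable clopen sets are cofinal and locally small.

    (2) If [p] is contained in [a p] in the cofinal family [A], then for [p] inside
    [q] the set [b = a p] meet [a q] is a trace on both [a p] and [a q].  Well-order
    the subsets of each such [b] in type at most omega_1: the earlier of [p] and
    [q] meet [b] interpolates, and it occurs among the countably many candidates
    attached to either of [p] and [q].

    (3)-(5) Closing a set under [F], under subsets and under finitely many further
    operations produces at most continuum many sets.  Unions of such closures are
    again closed, so any well-ordering of the sets yields a continuous chain of
    closed families [N] with increments of size omega_1, hence a well-order of the
    countable sets in which the predecessors of [X] are a closed family [N] and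
    countably many further sets.  The members of [N] contained in [X] have the
    countable cofinal family [F X] meet [N], so every recursion along this order
    meets only countably many requirements at each step.  This gives the saturated
    family; a cofinal family of which each countable set contains only countably
    many members, whence the base for Nt; and injections [phi X] of all countable
    [X] into nat such that [phi X] and [phi Y] are, on the intersection of [X] and
    [Y], order-isomorphic on each piece of a finite partition.  The permutations
    which preserve the last structure form a group that is omega-homogeneous, as
    any two infinite subsets of nat are order-isomorphic, but not omega-transitive,
    as some injection of nat is not a finite union of increasing maps. *)

From mathcomp Require Import all_boot.
From mathcomp Require Import boolp classical_sets functions cardinality zify.
From mathcomp Require wochoice.
Require Import Defs.
Set Implicit Arguments. Unset Strict Implicit. Unset Printing Implicit Defensive.
Local Open Scope classical_set_scope.
Local Open Scope card_scope.

(** * Countable sets, well-founded recursion and CH *)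

Definition inj_on T U (A : set T) (f : T -> U) :=
  forall x y, A x -> A y -> f x = f y -> x = y.

Lemma inj_onP T U (A : set T) (f : T -> U) : inj_on A f <-> {in A &, injective f}.
Proof.
split=> [fA x y /set_mem Ax /set_mem Ay|fA x y Ax Ay]; first exact: fA.
by apply: fA; exact: mem_set.
Qed.

Lemma countable_inj_on T (A : set T) :
  countable A -> exists f : T -> nat, inj_on A f.
Proof. by move=> /countable_injP[f fA]; exists f; apply/(inj_onP A). Qed.

Lemma inj_on_countable T U (A : set T) (B : set U) (f : T -> U) :
  inj_on A f -> (forall x, A x -> B (f x)) -> countable B -> countable A.
Proof.
move=> fA fAB /countable_inj_on[g gB]; apply/countable_injP; exists (g \o f).
by apply/(inj_onP A) => x y Ax Ay /= /(gB _ _ (fAB _ Ax) (fAB _ Ay)); exact: fA.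
Qed.

Lemma image_countable T U (A : set T) (f : T -> U) : countable A -> countable (f @` A).
Proof. exact/sub_countable/card_image_le. Qed.

Lemma subset_countable T (A B : set T) : A `<=` B -> countable B -> countable A.
Proof. by move=> /subset_card_le; exact: sub_countable. Qed.

Lemma setU_countable T (A B : set T) : countable A -> countable B -> countable (A `|` B).
Proof.
move=> cA cB; have -> : A `|` B = \bigcup_(b in [set: bool]) if b then A else B.
  apply/seteqP; split=> [x [Ax|Bx]|x [[] _ ?]]; [by exists true|by exists false|by left|by right].
by apply: bigcup_countable => // -[].
Qed.

Lemma countable_enum T (A : set T) : countable A -> A !=set0 ->
  exists e : nat -> T, A = range e.
Proof.
move=> /countable_inj_on[f fA] [a Aa].
have /choice[e eP] (n : nat) : exists x, A x /\ ((exists2 y, A y & f y = n) -> f x = n).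
  have [[y Ay fy]|N] := pselect (exists2 y, A y & f y = n); first by exists y.
  by exists a.
exists e; apply/seteqP; split=> [x Ax|_ [n _ <-]]; last by have [] := eP n.
exists (f x) => //; have [Ae fe] := eP (f x).
by apply: fA => //; apply: fe; exists x.
Qed.

(** The empty set pads the family, so that an empty [C] can be enumerated too; it imposes nothing in
    the later constructions. *)
Lemma countable_enum_set0 T (C : set (set T)) : countable C ->
  exists E : nat -> set T, (forall n, C (E n) \/ E n = set0) /\ C `<=` range E.
Proof.
move=> cC; have [|E CE] := @countable_enum _ (set0 |` C) (setU_countable (countable1 _) cC).
  by exists set0; left.
exists E; split=> [n|]; last by rewrite -CE; right.
have : (set0 |` C) (E n) by rewrite CE; exists n.
by case; [right|left].
Qed.

Lemma infinite_unbounded T (A : set T) (f : T -> nat) n :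
  infinite_set A -> inj_on A f -> exists2 x, A x & n <= f x.
Proof.
move=> iA fA; apply: contrapT => N; apply: iA.
suff : finite_set (f @` A).
  by rewrite (eq_finite_set (inj_card_eq (proj1 (inj_onP A f) fA))).
apply: (sub_finite_set _ (finite_II n)) => _ [x Ax <-] /=.
by rewrite ltnNge; apply/negP => le; apply: N; exists x.
Qed.

Lemma ctinf_sub T (A B : set T) : A `<=` B -> countable B -> infinite_set A -> ctinf A.
Proof. by move=> AB cB iA; split=> //; apply: subset_countable cB. Qed.

Lemma uncountable_setD T (A B : set T) : ~ countable A -> countable B -> ~ countable (A `\` B).
Proof.
move=> nA cB cD; apply: nA; apply: subset_countable (setU_countable cB cD) => x Ax.
by have [Bx|nB] := pselect (B x); [left|right].
Qed.

Lemma uncountable_infinite T (A : set T) : ~ countable A -> infinite_set A.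
Proof. by move=> nA /finite_set_countable. Qed.

Lemma infinite_ctinf_sub T (A : set T) : infinite_set A -> exists2 B, ctinf B & B `<=` A.
Proof.
elim/Ppointed: T => T in A *.
  by rewrite emptyE => /infinite_setN0[].
move=> /infiniteP/ppcard_leP[f].
exists (range f); last by move=> _ [n _ <-]; exact: (@funS _ _ _ _ f).
split; first by apply: image_countable; exact: countableP.
apply/infiniteP; have /card_eqPle[]// : range f #= [set: nat] by apply: card_image.
Qed.

(** Recursion by choice along [R]: an acceptable value is picked from the earlier ones, extended by
    a default off the predecessors. Locality of [Q] in [f] makes the default harmless, and a value
    has to exist only where all earlier ones are acceptable. *)
Lemma wf_construct T (U : Type) (R : T -> T -> Prop) (Q : T -> (T -> U) -> U -> Prop) :
  inhabited U -> well_founded R ->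
  (forall x f g u, (forall y, R y x -> f y = g y) -> Q x f u -> Q x g u) ->
  (forall x f, (forall y, R y x -> Q y f (f y)) -> exists u, Q x f u) ->
  exists f, forall x, Q x f (f x).
Proof.
move=> [u0] wfR Qext Qex.
pose ext x (rec : forall y, R y x -> U) y :=
  if pselect (R y x) is left h then rec y h else u0.
have /choice[pick pickP] (xf : T * (T -> U)) :
    exists u, (exists v, Q xf.1 xf.2 v) -> Q xf.1 xf.2 u.
  have [[v Qv]|N] := pselect (exists v, Q xf.1 xf.2 v); first by exists v.
  by exists u0.
pose F x rec := pick (x, @ext x rec).
pose f := Fix wfR (fun _ => U) F.
have fE x : f x = pick (x, fun y => if pselect (R y x) then f y else u0).
  rewrite /f Fix_eq; last first.
    move=> y g h gh; rewrite /F; congr (pick (_, _)); apply/funext => z; rewrite /ext.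
    by case: pselect.
  by rewrite /F; congr (pick (_, _)); apply/funext => z; rewrite /ext; case: pselect.
exists f => x; elim/(well_founded_ind wfR): x => x IH; rewrite fE.
set g := fun y => _; have gf y : R y x -> g y = f y by rewrite /g; case: pselect.
apply: (Qext _ g) => //; apply: (pickP (x, g)) => /=.
have [u Qu] := Qex _ _ IH; exists u; apply: Qext Qu => y Ryx; by rewrite gf.
Qed.

(** * Strict well-orders *)

Definition strict_wo T (R : T -> T -> Prop) :=
  [/\ well_founded R, (forall x y z, R x y -> R y z -> R x z)
    & forall x y, x <> y -> R x y \/ R y x].

Lemma strict_wo_irr T (R : T -> T -> Prop) x : strict_wo R -> ~ R x x.
Proof. by case=> wf _ _; elim/(well_founded_ind wf): x => x IH /[dup] /IH. Qed.

Lemma well_founded_min T (R : T -> T -> Prop) (P : T -> Prop) : well_founded R ->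
  (exists x, P x) -> exists2 x, P x & forall y, R y x -> ~ P y.
Proof.
move=> wfR [x Px]; apply: contrapT => N; move: x Px.
apply: (well_founded_ind wfR) => x IH Px.
by apply: N; exists x => // y Ryx Py; exact: IH Ryx Py.
Qed.

Lemma strict_wo_exists (T : Type) : exists R : T -> T -> Prop, strict_wo R.
Proof.
elim/Pchoice: T => T; have [R wo] := wochoice.well_ordering_principle T.
have minE (P : set T) : P !=set0 -> exists2 x, P x & forall y, P y -> R x y.
  move=> [x Px]; have [|z [[/asboolP Pz zmin] _]] := wo (fun x => `[<P x>]).
    by exists x; apply/asboolP.
  by exists z => // y Py; apply: zmin; apply/asboolP.
have Rtot x y : R x y \/ R y x.
  have [|z [->|->] m] := minE [set x; y]; first by exists x; left.
    by left; apply: m; right.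
  by right; apply: m; left.
have Ranti x y : R x y -> R y x -> x = y.
  (* Both points are least in the pair, and least elements are unique. *)
  move=> xy yx; have [|z zu] := wo (fun z => `[<z = x \/ z = y>]).
    by exists x; apply/asboolP; left.
  have Rr z' : R z' z' by case: (Rtot z' z').
  transitivity z; [symmetry|]; apply: (proj2 zu); split; try (by apply/asboolP; tauto);
  by move=> t /asboolP[->|->].
have Rtr x y z : R x y -> R y z -> R x z.
  move=> xy yz; have [|t tP m] := minE [set x; y; z]; first by exists x; do 2 left.
  have mx : R t x by apply: m; do 2 left.
  have my : R t y by apply: m; left; right.
  have mz : R t z by apply: m; right.
  move: tP => [[tx|ty]|tz]; first by rewrite -tx.
    by rewrite (Ranti x y) // -ty.
  by rewrite tz in my; rewrite -(Ranti y z).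
exists (fun x y => R x y /\ x <> y); split.
- move=> x; apply: contrapT => nx.
  have [|z nz m] := minE [set z | ~ Acc (fun x y => R x y /\ x <> y) z]; first by exists x.
  apply: nz; constructor=> y [yz yNz]; apply: contrapT => ny.
  by apply: yNz; apply: Ranti => //; apply: m.
- move=> x y z [xy nxy] [yz nyz]; split; first exact: Rtr yz.
  by move=> xz; rewrite xz in xy nxy; apply: nyz; apply: Ranti.
- by move=> x y nxy; case: (Rtot x y) => ?; [left|right]; split=> // /esym.
Qed.

Lemma inj_into T U (B : set U) : [set: T] #<= B -> B !=set0 ->
  exists h : T -> U, inj_on setT h /\ forall x, B (h x).
Proof.
elim/Ppointed: U => U in B *; first by move=> _ [x]; case: (no x).
move=> /pcard_leP[f] _; exists f; split=> [x y _ _ /(inj (f := f))|x].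
  by apply; rewrite inE.
exact: (@funS _ _ _ _ f).
Qed.

Lemma strict_wo_preim T U (R : U -> U -> Prop) (h : T -> U) :
  inj_on setT h -> strict_wo R -> strict_wo (fun x y => R (h x) (h y)).
Proof.
move=> hinj [wf tr tot]; split=> [x|x y z|x y nxy]; last 2 first.
- exact: tr.
- by apply: tot => /(hinj x y I I).
have [u ux] : exists u, u = h x by exists (h x).
elim/(well_founded_ind wf): u x ux => u IH x ux.
by constructor=> y; rewrite -ux => Ryu; exact: (IH (h y)).
Qed.

(** * CH as a well-order of the reals with countable initial segments *)

Definition ctbl_wo T (R : T -> T -> Prop) :=
  strict_wo R /\ forall x, countable [set y | R y x].

(** Take any well-order of the reals. If some initial segment is uncountable, the least such one has
    the size of the continuum by CH, and the reals inherit its order, whose own initial segments are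
    countable by minimality. *)
Lemma CH_order : GCH -> exists R : set nat -> set nat -> Prop, ctbl_wo R.
Proof.
move=> gch; have [R swoR] := strict_wo_exists (set nat); have [wf tr _] := swoR.
have [x0N|/existsNP x0N] := pselect (forall x, countable [set y | R y x]); first by exists R.
have [x nx m] := well_founded_min wf x0N.
pose A := [set y | R y x].
have iA : infinite_set A by apply: uncountable_infinite.
have /infiniteP nA := iA.
have [eA|eA] := gch nat A infinite_nat nA.
  by case: nx; rewrite -/A; have /card_eqPle[] := eA.
have [|//|h [hinj hA]] := @inj_into (set nat) _ A.
- by have /card_eqPle[] := eA.
- exact: infinite_setN0.
exists (fun x y => R (h x) (h y)); split; first exact: strict_wo_preim.
move=> y; have /contrapT := m _ (hA y).
apply: (@inj_on_countable _ _ _ _ h) => [u v _ _|u //].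
exact: (hinj u v I I).
Qed.

(** Only countably many values precede each stage, so the uncountable [S] always offers a new
    one. *)
Lemma CH_inj_uncountable (R : set nat -> set nat -> Prop) T (S : set T) :
  ctbl_wo R -> ~ countable S ->
  exists nu : set nat -> T, inj_on setT nu.
Proof.
move=> [[wf _ tot] cR] nS.
have [s0 Ss0] := infinite_setN0 (uncountable_infinite nS).
have [||nu nuP] := @wf_construct _ T R (fun x f u => forall y, R y x -> f y <> u) (inhabits s0) wf.
- by move=> x f g u fg H y Ryx; rewrite -fg //; exact: H.
- move=> x f _; have nD : ~ countable (S `\` (f @` [set y | R y x])).
    by apply: uncountable_setD => //; apply: image_countable.
  have [u [Su nu]] := infinite_setN0 (uncountable_infinite nD).
  by exists u => y Ryx fy; apply: nu; exists y.
exists nu => x y _ _ xy; apply: contrapT => /tot[] /nuP; first by rewrite xy.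
by rewrite xy.
Qed.

Lemma aleph_omega_uncountable (K : Type) : is_aleph_omega K -> ~ countable [set: K].
Proof.
move=> [S [[cS iS] _ suc _]] cK; have [[_ nle] _] := suc 0.
apply: nle; have cS1 : countable (S 1) by apply: subset_countable cK.
by apply: card_le_trans cS1 _; apply/infiniteP.
Qed.

(** * CLS implies wFN *)

Lemma image_inj_sub T U (b p q : set T) (f : T -> U) : inj_on b f ->
  p `<=` b -> q `<=` b -> f @` p = f @` q -> p = q.
Proof.
move=> fb; suff H p' q' : p' `<=` b -> q' `<=` b -> f @` p' = f @` q' -> p' `<=` q'.
  by move=> pb qb e; apply/seteqP; split; apply: H.
move=> pb qb e x px; have : (f @` q') (f x) by rewrite -e; exists x.
by case=> y qy /fb <- //; [exact: qb|exact: pb].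
Qed.

Lemma ctbl_wo_le_countable T (R : T -> T -> Prop) x : ctbl_wo R -> countable [set y | ~ R x y].
Proof.
move=> [[_ _ tot] cR]; apply: subset_countable (setU_countable (countable1 x) (cR x)) => y /= nxy.
by have [->|/tot[]] := pselect (y = x); [left|right|].
Qed.

Lemma CLS_wFN (K : Type) (R : set nat -> set nat -> Prop) :
  ctbl_wo R -> CLS K -> wFN K.
Proof.
move=> woR [A [Act Acof Als]]; have [swo _] := woR; have [_ _ tot] := swo.
have /choice[a aP] (p : set K) : exists c, ctinf p -> A c /\ p `<=` c.
  have [/Acof[c Ac pc]|np] := pselect (ctinf p); first by exists c.
  by exists set0.
have /choice[j jP] (b : set K) : exists f : K -> nat, countable b -> inj_on b f.
  have [/countable_inj_on[f fb]|nb] := pselect (countable b); first by exists f.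
  by exists (fun=> 0).
(* The traces on the cofinal set chosen above [p]; there are countably many by local smallness. *)
pose T p := [set a p `&` c | c in A].
(* Candidates are the subsets of a trace [b] that come no later than [p] meet [b], where [j b]
   transports the well-order of the reals to the subsets of [b]. *)
pose F p := [set s : set K | ctinf s /\ exists2 b, T p b &
  s `<=` b /\ ~ R (j b @` (p `&` b)) (j b @` s)].
exists F; split=> [p cp|p q cp cq pq].
  split=> [s []//|]; have [Aap pap] := aP _ cp.
  have cT : countable (T p) by exact: Als _ (Act _ Aap).
  have sub : F p `<=` \bigcup_(b in T p)
      [set s | s `<=` b /\ ~ R (j b @` (p `&` b)) (j b @` s)].
    by move=> s [_ [b Tb sb]]; exists b.
  apply: subset_countable sub _; apply: bigcup_countable => // b [c Ac bE].
  have jb : inj_on b (j b).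
    by apply: jP; rewrite -bE; apply: (subset_countable (@subIsetl _ _ _)); case: (Act _ Aap).
  apply: (@inj_on_countable _ _ _ [set y | ~ R (j b @` (p `&` b)) y] (fun s => j b @` s)).
  - move=> s t [sb _] [tb _]; exact: (image_inj_sub jb).
  - by move=> s [].
  - exact: ctbl_wo_le_countable.
have [Aap pap] := aP _ cp; have [Aaq qaq] := aP _ cq.
set b := a p `&` a q; have pb : p `<=` b by move=> x px; split; [exact: pap|exact/qaq/pq].
have Tp : T p b by exists (a q).
have Tq : T q b by exists (a p) => //; rewrite setIC.
have cqb : ctinf (q `&` b).
  split; first by apply: (subset_countable (@subIsetl _ _ _)); case: cq.
  by apply: sub_infinite_set (proj2 cp) => x px; split; [exact: pq|exact: pb].
have pI : p `&` b = p by apply/setIidPl.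
have [le|gt] := pselect (R (j b @` p) (j b @` (q `&` b))).
  exists p; split=> //; split=> //; exists b => //; split=> //; rewrite ?pI.
    exact: strict_wo_irr.
  have [_ tr _] := swo; move=> gt; exact: (strict_wo_irr swo (tr _ _ _ le gt)).
exists (q `&` b); split=> //.
- by split=> //; exists b => //; split; [exact: subIsetr|rewrite pI].
- by split=> //; exists b => //; split; [exact: subIsetr|exact: strict_wo_irr].
- by move=> x px; split; [exact: pq|exact: pb].
Qed.

(** * Well-orders adapted to a weak Freese-Nation function *)

(** This numbers finite histories of operations by reals. Tagged triples record the length (tag 0),
    the numbers (tag 1) and the elements of the sets (tag 2). *)
Lemma seq_code : exists code : seq (nat * set nat) -> set nat, injective code.
Proof.
pose z : nat * set nat := (0, set0).
pose code (l : seq (nat * set nat)) : set nat := [set m | exists t : nat * (nat * nat),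
  m = pickle t /\ [\/ t = (0, (size l, 0)), exists i, t = (1, (i, (nth z l i).1)) |
    exists i k, t = (2, (i, k)) /\ (nth z l i).2 k]].
have codeE l t : code l (pickle t) <->
  [\/ t = (0, (size l, 0)), exists i, t = (1, (i, (nth z l i).1)) |
    exists i k, t = (2, (i, k)) /\ (nth z l i).2 k].
  split=> [[t' [/(pcan_inj (@pickleK _)) <-]]//|h]; by exists t.
exists code => l l' ll'.
have E t : code l (pickle t) <-> code l' (pickle t) by rewrite ll'.
apply: (@eq_from_nth _ z).
  have /E/codeE : code l (pickle (0, (size l, 0))) by apply/codeE/Or31.
  by case=> [[]//|[i //]|[i [k []]]].
move=> i _; rewrite [LHS]surjective_pairing [RHS]surjective_pairing; congr (_, _).
  have /E/codeE : code l (pickle (1, (i, (nth z l i).1))) by apply/codeE/Or32; exists i.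
  by case=> [[]//|[j [-> ->]]//|[j [k []]]].
apply/seteqP; split=> k kP.
  have /E/codeE : code l (pickle (2, (i, k))) by apply/codeE/Or33; exists i, k.
  by case=> [[]//|[j []]//|[j [m [[-> ->]]]]].
have /E/codeE : code l' (pickle (2, (i, k))) by apply/codeE/Or33; exists i, k.
by case=> [[]//|[j []]//|[j [m [[-> ->]]]]].
Qed.

(* [rho] assigns to each countable set the block it is created in; a block is the part
   of a continuum-sized set closed under subsets, [F] and adding points of [range nu]
   that lies in no earlier such set. The function [i] numbers the elements of a block by
   reals. *)
Definition blocks K (nu : set nat -> K) (F : set K -> set (set K))
    (R : set K -> set K -> Prop) (rho : set K -> set K) (i : set K -> set nat) :=
  [/\ strict_wo R,
      forall X Y, rho X = rho Y -> i X = i Y -> X = Y,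
      forall X Y, ctinf X -> Y `<=` X -> ~ R (rho X) (rho Y),
      forall X c, ctinf X -> ~ R (rho X) (rho (nu c |` X))
    & forall X Y, ctinf X -> F X Y -> ~ R (rho X) (rho Y)].

(** [rho p] is the least set from which finitely many operations [st] lead to [p], and [i p] encodes
    such a list of operations. Appending one more operation to the list of [X] shows that no
    operation moves [X] to a later block. *)
Lemma blocks_exist K (nu : set nat -> K) (F : set K -> set (set K)) :
  (forall p, ctinf p -> countable (F p)) -> exists R rho i, blocks nu F R rho i.
Proof.
move=> cF; have [R swo] := strict_wo_exists (set K); have [wf tr tot] := swo.
have [code codeI] := seq_code.
have /choice[e eP] (p : set K) : exists f : K -> nat, ctinf p -> inj_on p f.
  have [[/countable_inj_on[f fp] _]|np] := pselect (ctinf p); first by exists f.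
  by exists (fun=> 0).
have /choice[G GP] (p : set K) : exists E : nat -> set K, ctinf p -> F p `<=` range E.
  have [/cF/countable_enum_set0[E [_ FE]]|np] := pselect (ctinf p); first by exists E.
  by exists (fun=> set0).
(* Operation 0 adds the point [nu o.2], operation 1 cuts [p] down to the subset coded by [o.2], and
   operation [m.+2] passes to the [m]-th member of [F p]. *)
pose st (p : set K) (o : nat * set nat) : set K :=
  if o.1 is n.+1 then (if n is m.+1 then G p m else [set x | p x /\ o.2 (e p x)])
  else nu o.2 |` p.
have /choice[rho rhoP] (p : set K) : exists q, (exists l, foldl st q l = p) /\
    forall q' l, foldl st q' l = p -> ~ R q' q.
  have [|q pq m] := @well_founded_min _ _ (fun q => exists l, foldl st q l = p) wf.
    by exists p, [::].
  by exists q; split=> // q' l ql /m; apply; exists l.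
have /choice[l lP] p : exists l, foldl st (rho p) l = p by case: (rhoP p).
have step X o : ~ R (rho X) (rho (st X o)).
  by apply: (proj2 (rhoP (st X o)) _ (rcons (l X) o)); rewrite foldl_rcons lP.
exists R, rho, (code \o l); split=> //.
- by move=> X Y eqr /= /codeI eql; rewrite -[LHS]lP -[RHS]lP eqr eql.
- move=> X Y cX YX; suff <- : st X (1, e X @` Y) = Y by exact: step.
  apply/seteqP; split=> [x [/= Xx [y Yy /(eP _ cX)]]|x Yx].
    by move=> <- //; exact: YX.
  by split; [exact: YX|exists x].
- by move=> X c _; exact: (step X (0, c)).
- by move=> X Y cX /(GP _ cX)[n _ <-]; exact: (step X (n.+2, set0)).
Qed.

Definition lexi_lt A B T (RA : A -> A -> Prop) (RB : B -> B -> Prop)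
    (f : T -> A) (g : T -> B) x y :=
  RA (f x) (f y) \/ (f x = f y /\ RB (g x) (g y)).

Lemma lexi_strict_wo A B T (RA : A -> A -> Prop) (RB : B -> B -> Prop)
    (f : T -> A) (g : T -> B) :
  strict_wo RA -> strict_wo RB -> (forall x y, f x = f y -> g x = g y -> x = y) ->
  strict_wo (lexi_lt RA RB f g).
Proof.
move=> [wfA trA totA] [wfB trB totB] fg; split.
- move=> x; have [a xa] : exists a, f x = a by exists (f x).
  elim/(well_founded_ind wfA): a x xa => a IHa x xa.
  have [b xb] : exists b, g x = b by exists (g x).
  elim/(well_founded_ind wfB): b x xa xb => b IHb x xa xb.
  constructor=> y [Ryx|[yx Ryx]].
    by rewrite xa in Ryx; exact: (IHa _ Ryx y (erefl _)).
  by rewrite xb in Ryx; rewrite xa in yx; exact: (IHb _ Ryx y yx (erefl _)).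
- move=> x y z [xy|[exy xy]] [yz|[eyz yz]]; rewrite /lexi_lt.
  + by left; exact: trA yz.
  + by left; rewrite -eyz.
  + by left; rewrite exy.
  + by right; rewrite exy; split=> //; exact: trB yz.
- move=> x y nxy; have [efg|/totA[]] := pselect (f x = f y); [|by left; left|by right; left].
  have /totB[] : g x <> g y by move=> /(fg _ _ efg).
    by left; right.
  by right; right.
Qed.

(** How the closure conditions are used: if [Y] is in [N X], so is every countably infinite part [Z]
    of [Y] inside [X], and hence also an interpolant of [Z] and [X], as it belongs to [F Z]. It
    belongs to [F X] as well, so countably many sets control all of [N X]. *)
Definition wFN_order K (F : set K -> set (set K)) (lt : set K -> set K -> Prop)
    (N : set K -> set (set K)) :=
  [/\ strict_wo lt,
      forall X Y, N X Y -> lt Y X,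
      forall X, countable [set Y | lt Y X /\ ~ N X Y],
      forall X Y Z, ctinf Y -> N X Y -> Z `<=` Y -> N X Z
    & forall X Y Z, ctinf Y -> N X Y -> F Y Z -> N X Z].

Lemma strict_wo_le_lt T (R : T -> T -> Prop) x y z :
  strict_wo R -> ~ R y x -> R y z -> R x z.
Proof.
by move=> [_ tr tot] nyx yz; have [->//|/tot[/tr|//]] := pselect (x = y); exact.
Qed.

(** Sets are ordered by block, then by number within the block. The closed part [N X] consists of
    the earlier blocks; the remaining predecessors have a smaller number than [X], so they are
    countably many. *)
Lemma wFN_order_exists K (Rc : set nat -> set nat -> Prop) (nu : set nat -> K)
    (F : set K -> set (set K)) :
  ctbl_wo Rc -> (forall p, ctinf p -> countable (F p)) ->
  exists lt N, wFN_order F lt N.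
Proof.
move=> [swoc cRc] /(blocks_exist nu)[R [rho [i [swo ri rsub _ rF]]]].
exists (lexi_lt R Rc rho i), (fun X Y => R (rho Y) (rho X)); split.
- exact: lexi_strict_wo.
- by left.
- move=> X; apply: (@inj_on_countable _ _ _ [set c | Rc c (i X)] i) => //.
    by move=> Y Z [[//|[eY _]] _] [[//|[eZ _]] _]; apply: ri; rewrite eY.
  by move=> Y [[//|[]]].
- by move=> X Y Z cY NY ZY; apply: strict_wo_le_lt NY => //; exact: rsub.
- by move=> X Y Z cY NY FZ; apply: strict_wo_le_lt NY => //; exact: rF.
Qed.

(** * wFN implies SAT *)

Definition covered T (A : set (set T)) (X : set T) :=
  exists A', [/\ finite_set A', A' `<=` A & almost_sub X (\bigcup_(a in A') a)].

Lemma covered1 T (A : set (set T)) a : A a -> covered A a.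
Proof.
move=> Aa; exists [set a]; split; [exact: finite_set1|by move=> _ ->|].
by apply: sub_finite_set (finite_set0 _) => x []; rewrite bigcup_set1.
Qed.

Lemma covered_bigcup T (A : set (set T)) (E : nat -> set T) n :
  (forall i, covered A (E i)) -> covered A (\bigcup_(i < n) E i).
Proof.
move=> cE; elim: n => [|n [A0 [fA0 sA0 h0]]].
  exists set0; split=> //; apply: sub_finite_set (finite_set0 _) => x [[i]].
  by rewrite /= ltn0.
have [A1 [fA1 sA1 h1]] := cE n.
exists (A0 `|` A1); split; first by rewrite finite_setU.
  by move=> a [/sA0|/sA1].
have : finite_set ((\bigcup_(i < n) E i) `\` \bigcup_(a in A0) a `|` E n `\` \bigcup_(a in A1) a).
  by rewrite finite_setU.
apply: sub_finite_set => x [[i /=]]; rewrite ltnS leq_eqVlt => /orP[/eqP->|lin] Ex nx.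
  by right; split=> // -[a Aa ax]; apply: nx; exists a => //; right.
left; split; first by exists i.
by move=> [a Aa ax]; apply: nx; exists a => //; left.
Qed.

Lemma covered_sub_mod T (A : set (set T)) (X Y : set T) :
  almost_sub X Y -> covered A Y -> covered A X.
Proof.
move=> XY [A' [fA' sA' h]]; exists A'; split=> //.
have : finite_set (X `\` Y `|` Y `\` \bigcup_(a in A') a) by rewrite finite_setU.
apply: sub_finite_set => x [Xx nx].
by have [Yx|nY] := pselect (Y x); [right|left].
Qed.

Lemma finite_bounded T (A : set T) (f : T -> nat) :
  finite_set A -> exists n, forall x, A x -> f x < n.
Proof.
move=> /(finite_image f)/finite_seqP[s sE]; exists (\max_(i <- s) i).+1 => x Ax.
have : (f @` A) (f x) by exists x.
by rewrite sE /= => fs; rewrite ltnS; exact: (@leq_bigmax_seq _ _ xpredT id _ fs).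
Qed.

(** Choose [x n] in [X] outside [E 0], ..., [E (n-1)], with [phi (x n)] at least [n] to get
    infinitely many points. Then [E n] contains at most [x 0], ..., [x n]. *)
Lemma diagonal_subset T (X : set T) (E : nat -> set T) :
  countable X -> (forall n, infinite_set (X `\` \bigcup_(i < n) E i)) ->
  exists u, [/\ ctinf u, u `<=` X & forall n, finite_set (E n `&` u)].
Proof.
move=> cX iX; have [phi phiX] := countable_inj_on cX.
have /choice[x xP] (n : nat) : exists x, (X `\` \bigcup_(i < n) E i) x /\ n <= phi x.
  have phiD : inj_on (X `\` \bigcup_(i < n) E i) phi by move=> x y [Xx _] [Xy _]; exact: phiX.
  by have [x Xx le] := infinite_unbounded n (iX n) phiD; exists x.
exists (range x); split.
- split; first by apply: image_countable; exact: countableP.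
  move=> /(finite_bounded phi)[n nP]; have := nP (x n) (ex_intro2 _ _ n I (erefl _)).
  by rewrite ltnNge; case: (xP n) => _ ->.
- by move=> _ [n _ <-]; case: (xP n) => -[].
- move=> n; apply: sub_finite_set (finite_image x (finite_II n.+1)).
  move=> t [Ent [m _ mx]]; exists m => //=; rewrite ltnS leqNgt; apply/negP => nm.
  by case: (xP m) => -[_ nE] _; apply: nE; exists n => //; rewrite mx.
Qed.

Lemma wFN_SAT (K : Type) (Rc : set nat -> set nat -> Prop) (nu : set nat -> K) :
  ctbl_wo Rc -> wFN K -> SAT K.
Proof.
move=> woc [F [FP Fint]].
have [|lt [N [swo Nlt cN Nsub NF]]] := wFN_order_exists nu woc (F := F).
  by move=> p /FP[].
have [wf tr tot] := swo.
pose prev X (f : set K -> set K) : set (set K) :=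
  [set a | ctinf a /\ exists2 Y, lt Y X & f Y = a].
(* The empty value records that [X], if countably infinite, is settled by the earlier members; any
   other value is a new member inside [X], almost disjoint from all earlier values. *)
pose Q X f (u : set K) := (u = set0 /\
    (ctinf X -> (exists2 a, prev X f a & a `<=` X) \/ covered (prev X f) X)) \/
  [/\ ctinf u, u `<=` X, countable X & forall Y, lt Y X -> finite_set (f Y `&` u)].
have prevE X f g : (forall Y, lt Y X -> f Y = g Y) -> prev X f `<=` prev X g.
  by move=> fg a [ca [Y YX fY]]; split=> //; exists Y => //; rewrite -fg.
have [||f fP] := @wf_construct _ _ lt Q (inhabits set0) wf.
- move=> X f g u fg [[u0 H]|[cu uX cX H]]; [left|right].
    split=> // /H[[a pa aX]|[A' [fA' sA' h]]]; [left|right].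
      by exists a => //; exact: (prevE _ _ _ fg).
    by exists A'; split=> // a /sA'; exact: prevE.
  by split=> // Y YX; rewrite -fg //; exact: H.
- move=> X f IH.
  have [cX|ncX] := pselect (ctinf X); last by exists set0; left.
  have [[a pa aX]|nc] := pselect (exists2 a, prev X f a & a `<=` X).
    by exists set0; left; split=> // _; left; exists a.
  have [covX|ncov] := pselect (covered (prev X f) X).
    by exists set0; left; split=> // _; right.
  (* The countably many sets to be avoided: members of [F X] in the closed family, and earlier
     members created outside it. *)
  pose C := [set B | [/\ F X B, N X B & B `<=` X]] `|`
            [set a | prev X f a /\ exists2 Y, lt Y X /\ ~ N X Y & f Y = a].
  have cC : countable C.
    apply: setU_countable.
      by apply: subset_countable (proj2 (FP _ cX)) => B [].
    by apply: subset_countable (image_countable f (cN X)) => a [_ [Y YX <-]]; exists Y.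
  have prev_sub Y : lt Y X -> prev Y f `<=` prev X f.
    by move=> YX a [ca [Z ZY fZ]]; split=> //; exists Z => //; exact: tr YX.
  (* A set [B] of the first kind was treated earlier. No member lies inside it, since that member
     would lie inside [X]; so it was found to be covered. *)
  have covC B : C B -> covered (prev X f) B.
    case=> [[FB NB BX]|[pB _]]; last exact: covered1.
    have cB : ctinf B by apply: (proj1 (FP _ cX)).
    have BltX := Nlt _ _ NB.
    case: (IH B BltX) => [[_ /(_ cB)]|[cu uB _ _]]; last first.
      by case: nc; exists (f B); [split=> //; exists B|exact: subset_trans BX].
    case=> [[a pa aB]|[A' [fA' sA' h]]].
      by case: nc; exists a; [exact: prev_sub pa|exact: subset_trans BX].
    by exists A'; split=> // a /sA'; exact: prev_sub.
  have cov0 : covered (prev X f) set0.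
    by exists set0; split=> //; apply: sub_finite_set (finite_set0 _) => x [].
  have [E [EC CE]] := countable_enum_set0 cC.
  have covE n : covered (prev X f) (E n) by case: (EC n) => [/covC|->].
  (* If finitely many [E i] contained almost all of [X], then [X] would be covered. *)
  have [|n|u [cu uX uE]] := @diagonal_subset _ X E; first by case: cX.
    by move=> fin; apply: ncov; apply: covered_sub_mod fin _; exact: covered_bigcup.
  exists u; right; split=> //; first by case: cX.
  move=> Y YX; apply: contrapT => ifY.
  have ctY : ctinf (f Y `&` u).
    by split=> //; apply: (subset_countable (@subIsetr _ _ _)); case: cu.
  case: (IH Y YX) => [[f0 _]|[cfY fYY cY _]].
    by apply: ifY; rewrite f0 set0I; exact: finite_set0.
  have [NY|nNY] := pselect (N X Y); last first.
    have [n _ En] : range E (f Y).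
      by apply: CE; right; split; [split=> //; exists Y|exists Y].
    by apply: ifY; rewrite -En.
  have ctYY : ctinf Y by split=> //; apply: sub_infinite_set (proj2 cfY).
  (* The intersection stays in the closed family, so an interpolant between it and [X] is one of the
     [E n]; but [u] meets every [E n] in a finite set. *)
  have NI : N X (f Y `&` u) by apply: (Nsub _ _ _ ctYY NY) => x [/fYY].
  have [r [Fr1 Fr2 sub1 sub2]] : exists r, [/\ F (f Y `&` u) r, F X r, f Y `&` u `<=` r & r `<=` X].
    by apply: Fint => // x [_ /uX].
  have [n _ En] : range E r.
    by apply: CE; left; split=> //; exact: (NF _ _ _ ctY NI).
  by apply: ifY; apply: sub_finite_set (uE n) => x fux; split; [rewrite En; exact: sub1|case: fux].
pose A := [set a | ctinf a /\ exists X, f X = a].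
have prevA X : prev X f `<=` A by move=> a [ca [Y _ fY]]; split=> //; exists Y.
have ADlt X Y : ctinf (f Y) -> lt X Y -> finite_set (f X `&` f Y).
  move=> cfY XY; case: (fP Y) => [[f0 _]|[_ _ _ H]]; last exact: H.
  by rewrite f0 setI0; exact: finite_set0.
exists A; split.
- by move=> a [].
- move=> a b [ca [X fX]] [cb [Y fY]] fXY; rewrite -fX -fY in ca cb fXY *.
  have /tot[/ADlt H|/ADlt H] : X <> Y by move=> XY; apply: fXY; rewrite XY.
    exact: H.
  by rewrite setIC; exact: H.
- move=> X cX; case: (fP X) => [[_ /(_ cX)]|[cf fX _ _]].
    case=> [[a pa aX]|[A' [fA' sA' h]]]; [left|right].
      by exists a => //; exact: prevA pa.
    by exists A'; split=> // a /sA'/prevA.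
  by left; exists (f X) => //; split=> //; exists X.
Qed.

(** * wFN implies Nt *)

(** The added point [nu (i X)] marks [X] within its block. If [a X] lies in [Y], then either [X] is
    in the block of [Y] and is determined by a point of [Y], or an interpolant in [F Y] from an
    earlier block contains [a X], and induction on the block of [Y] applies. *)
Lemma wFN_sparse_cofinal (K : Type) (nu : set nat -> K) :
  inj_on setT nu -> wFN K -> exists a : set K -> set K,
  [/\ forall X, ctinf X -> ctinf (a X), forall X, X `<=` a X &
      forall Y, ctinf Y -> countable [set X | ctinf X /\ a X `<=` Y]].
Proof.
move=> nuI [F [FP Fint]].
have [|R [rho [i [swo ri rsub rnu rF]]]] := blocks_exist nu (F := F).
  by move=> p /FP[].
have [wf _ tot] := swo; pose a X := nu (i X) |` X.
have Xa X : X `<=` a X by move=> x Xx; right.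
have cta X : ctinf X -> ctinf (a X).
  move=> [cX iX]; split; last exact: sub_infinite_set iX.
  by apply: setU_countable => //; exact: countable1.
exists a; split=> // Y; have [q Yq] : exists q, rho Y = q by exists (rho Y).
elim/(well_founded_ind wf): q Y Yq => q IH Y Yq cY.
pose C := [set B | [/\ F Y B & R (rho B) (rho Y)]].
have sub : [set X | ctinf X /\ a X `<=` Y] `<=`
  [set X | rho X = rho Y /\ a X `<=` Y] `|`
  \bigcup_(B in C) [set X | ctinf X /\ a X `<=` B].
  move=> X [cX aXY]; have [eXY|neXY] := pselect (rho X = rho Y); [by left|right].
  have RXY : R (rho X) (rho Y).
    by case: (tot _ _ neXY) => // /(rsub Y X cY)[]; exact: subset_trans aXY.
  (* Adding the marker does not lead to a later block, so the interpolant is early as well. *)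
  have RaXY : R (rho (a X)) (rho Y) by apply: strict_wo_le_lt RXY => //; exact: rnu.
  have [r [Fr FYr ar rY]] := Fint _ _ (cta _ cX) cY aXY.
  exists r => //; split=> //; apply: strict_wo_le_lt RaXY => //.
  by apply: rF => //; exact: cta.
apply: subset_countable sub _; apply: setU_countable.
  apply: (@inj_on_countable _ _ _ Y (nu \o i)); last by case: cY.
    by move=> X Z [eX _] [eZ _] /(nuI _ _ I I); apply: ri; rewrite eX.
  by move=> X [_]; apply; left.
apply: bigcup_countable => [|B [FB RB]].
  by apply: subset_countable (proj2 (FP _ cY)) => B [].
rewrite Yq in RB; apply: (IH _ RB) => //.
exact: (proj1 (FP _ cY)).
Qed.

(** * The G-delta modification of the Cantor cube *)

Definition cylinder K (x : K -> bool) (a : set K) : set (K -> bool) :=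
  [set y | forall k, a k -> y k = x k].

(** An explicit description by cylinders of countable support, identified below with the topology
    generated by the G-delta sets. *)
Definition delta_open K : set (set (K -> bool)) :=
  [set U | forall x, U x -> exists2 a, countable a & cylinder x a `<=` U].

Lemma delta_open_bigcap K (F : set (set (K -> bool))) :
  countable F -> F `<=` @delta_open K -> delta_open (\bigcap_(U in F) U).
Proof.
move=> cF FD x Fx.
have /choice[a aP] (U : set (K -> bool)) :
    exists a : set K, F U -> countable a /\ cylinder x a `<=` U.
  have [FU|nFU] := pselect (F U); last by exists set0.
  by have [a ca aU] := FD _ FU x (Fx _ FU); exists a.
exists (\bigcup_(U in F) a U).
  by apply: bigcup_countable => // U /aP[].
move=> y yP U FU; have [_] := aP _ FU; apply=> k ak; apply: yP.
by exists U.
Qed.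

Lemma delta_open_topology K : is_topology (@delta_open K).
Proof.
split=> [x []|x _|U V DU DV|F FD x [U FU Ux]].
- by exists set0; [exact: countable0|].
- suff -> : U `&` V = \bigcap_(W in [set U; V]) W.
    apply: delta_open_bigcap; first exact/finite_set_countable/finite_set2.
    by move=> W [->|->].
  by rewrite bigcap_setU !bigcap_set1.
- have [a ca aU] := FD _ FU x Ux; exists a => //.
  by move=> y /aU Uy; exists U.
Qed.

Lemma generated_topology T (G : set (set T)) : is_topology (generated G).
Proof.
split=> [op [op0 _ _ _] _//|op [_ opT _ _] _//|U V GU GV op top Gop|F FG op top Gop].
  by case: (top) => _ _ opI _; apply: opI; [exact: GU|exact: GV].
by case: (top) => _ _ _ opU; apply: opU => U /FG; apply.
Qed.

Lemma sub_generated T (G : set (set T)) : G `<=` generated G.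
Proof. by move=> U GU op _; apply. Qed.

Lemma delta_mod_cantorE K : delta_mod (@cantor_opens K) = @delta_open K.
Proof.
apply/seteqP; split=> [U|U DU].
  apply; first exact: delta_open_topology.
  move=> V [F [cF Fop ->]]; apply: delta_open_bigcap => // W /Fop.
  apply; first exact: delta_open_topology.
  move=> _ [k [b ->]] x xk; exists [set k]; first exact: countable1.
  by move=> y /(_ k (erefl k)) /= ->.
have [_ _ _ opU] := generated_topology (Gdelta (@cantor_opens K)).
have -> : U = \bigcup_(V in [set V | Gdelta (@cantor_opens K) V /\ V `<=` U]) V.
  apply/seteqP; split=> [x Ux|x [V [_ VU] /VU]//].
  have [a ca aU] := DU _ Ux; exists (cylinder x a) => //; split=> //.
  exists ((fun k => [set f : K -> bool | f k = x k]) @` a); split.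
  - exact: image_countable.
  - by move=> _ [k _ <-]; apply: sub_generated; exists k, (x k).
  - apply/seteqP; split=> [y yx _ [k ak <-]|y yx k ak]; first exact: yx.
    by apply: (yx [set f : K -> bool | f k = x k]); exists k.
by apply: opU => V [GV _]; exact: sub_generated.
Qed.

Lemma cylinder_self K (x : K -> bool) a : cylinder x a x. Proof. by []. Qed.

Lemma delta_open_cylinder K (x : K -> bool) a : countable a -> delta_open (cylinder x a).
Proof.
move=> ca y yx; exists a => // z zy k ak; by rewrite zy // yx.
Qed.

Lemma cylinder_sub K (x y : K -> bool) a b : cylinder x a `<=` cylinder y b ->
  b `<=` a /\ cylinder y b = cylinder x b.
Proof.
move=> xy; have xyb := xy x (@cylinder_self _ x a); split=> [k bk|]; last first.
  by apply/seteqP; split=> z zP k bk; rewrite zP // xyb.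
apply: contrapT => nak.
(* Flipping [x] at a coordinate of [b] outside [a] stays in the first cylinder and leaves the
   second. *)
pose x' := fun j => if pselect (j = k) then ~~ x k else x j.
have /xy/(_ k bk) : cylinder x a x'.
  by move=> j aj; rewrite /x'; case: pselect => // jk; rewrite jk in aj.
by rewrite /x' -xyb //; case: pselect => //; case: (x k).
Qed.

(** Around one point there is a strictly decreasing sequence of base members. Its intersection is
    still open, so it contains a base member, which then has infinitely many supersets. *)
Lemma delta_open_no_finite_base (K : Type) (B : set (set (K -> bool))) :
  ~ countable [set: K] -> is_base (@delta_open K) B ->
  ~ (forall b, B b -> finite_set (supersets_in B b)).
Proof.
move=> ncK [Bop Bbase] fB; pose x : K -> bool := fun=> false.
have /choice[st stP] (U : set (K -> bool)) : exists b, delta_open U -> U x ->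
    [/\ B b, b x, b `<=` U & ~ U `<=` b].
  have [[DU Ux]|N] := pselect (delta_open U /\ U x); last first.
    by exists set0 => DU Ux; case: N.
  have [a ca aU] := DU _ Ux.
  (* Fixing one coordinate outside the countable support [a] makes the next base member strictly
     smaller. *)
  have [k [_ nak]] := infinite_setN0 (uncountable_infinite (uncountable_setD ncK ca)).
  have [||b [Bb bx bc]] := Bbase (cylinder x (k |` a)) x.
  - by apply: delta_open_cylinder; apply: setU_countable => //; exact: countable1.
  - exact: cylinder_self.
  exists b => _ _; split=> //.
    by move=> y /bc yc; apply: aU => j aj; apply: yc; right.
  move=> Ub; pose y j := if pselect (j = k) then true else false.
  have /aU/Ub/bc/(_ k (or_introl (erefl k))) : cylinder x a y.
    by move=> j aj; rewrite /y; case: pselect => // jk; rewrite jk in aj.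
  by rewrite /y; case: pselect.
pose b n := iter n.+1 st setT.
have DT : delta_open [set: K -> bool] by have [] := delta_open_topology K.
have bP n : B (b n) /\ b n x.
  elim: n => [|n [/Bop Db bx]]; first by have [] := stP _ DT I.
  by have [] := stP _ Db bx.
have bS n : b n.+1 `<=` b n /\ ~ b n `<=` b n.+1.
  by have [/Bop Db bx] := bP n; have [] := stP _ Db bx.
have b_decr m n : m <= n -> b n `<=` b m.
  elim: n => [|n IH]; first by rewrite leqn0 => /eqP->.
  rewrite leq_eqVlt => /orP[/eqP-> //|/IH]; apply: subset_trans.
  exact: (proj1 (bS n)).
have b_inj : inj_on setT b.
  move=> m n _ _; wlog mn : m n / m < n => [W e|e].
    case: (ltngtP m n) => // [mn|nm]; first exact: W.
    by apply/esym; apply: W.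
  by case: (proj2 (bS m)); rewrite {1}e; exact: b_decr.
have [|c [Bc cx cb]] := Bbase (\bigcap_n b n) x _ (fun n _ => proj2 (bP n)).
  have -> : \bigcap_n b n = \bigcap_(U in range b) U by rewrite bigcap_image.
  apply: delta_open_bigcap; first by apply: image_countable; exact: countableP.
  by move=> _ [n _ <-]; apply: Bop; case: (bP n).
have : finite_set (range b).
  apply: sub_finite_set (fB _ Bc) => _ [n _ <-]; split; first by case: (bP n).
  by move=> y /cb; exact.
by rewrite (eq_finite_set (inj_card_eq (proj1 (inj_onP _ _) b_inj))); exact: infinite_nat.
Qed.

Lemma wFN_Nt (K : Type) (nu : set nat -> K) :
  inj_on setT nu -> ~ countable [set: K] -> wFN K -> Nt K.
Proof.
move=> nuI ncK /(wFN_sparse_cofinal nuI)[a [cta Xa ca]].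
rewrite /Nt delta_mod_cantorE; split; last first.
  by move=> [B [Bb fB]]; exact: delta_open_no_finite_base Bb fB.
(* [D] pads countable supports to infinite ones, to which [a] can be applied. *)
have [D cD _] := infinite_ctinf_sub (uncountable_infinite ncK).
exists [set U | exists x, exists2 X, ctinf X & U = cylinder x (a X)]; split.
  split=> [_ [x [X cX ->]]|U x DU Ux].
    by apply: delta_open_cylinder; case: (cta _ cX).
  have [c cc cU] := DU _ Ux; exists (cylinder x (a (c `|` D))); split.
  - exists x, (c `|` D) => //; split; first by apply: setU_countable => //; case: cD.
    by apply: sub_infinite_set (proj2 cD) => k; right.
  - exact: cylinder_self.
  - by move=> y yx; apply: cU => k ck; apply: yx; apply: Xa; left.
(* A base cylinder containing this one can be recentred at [x]; it is then determined by some [Z]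
   with [a Z] inside [a X]. *)
move=> _ [x [X cX ->]].
apply: subset_countable (image_countable (fun Z => cylinder x (a Z)) (ca _ (cta _ cX))).
move=> _ [[y [Z cZ ->]] /cylinder_sub[ZX ->]].
by exists Z.
Qed.

(** * wFN implies HnT *)

Definition coherent K (f g : K -> nat) (D : set K) := exists (C : finType) (c : K -> C),
  forall x y, D x -> D y -> c x = c y -> (f x < f y) = (g x < g y).

Lemma coherent_eq K (f g : K -> nat) D : (forall x, D x -> f x = g x) -> coherent f g D.
Proof. by move=> fg; exists unit, (fun=> tt) => x y Dx Dy _; rewrite !fg. Qed.

Lemma coherent_sym K (f g : K -> nat) D : coherent f g D -> coherent g f D.
Proof. by move=> [C [c cP]]; exists C, c => x y Dx Dy cxy; rewrite cP. Qed.

Lemma coherent_trans K (f g h : K -> nat) D :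
  coherent f g D -> coherent g h D -> coherent f h D.
Proof.
move=> [C [c cP]] [C' [c' cP']]; exists (C * C')%type, (fun x => (c x, c' x)).
by move=> x y Dx Dy [cxy cxy']; rewrite cP // cP'.
Qed.

Lemma coherent_sub K (f g : K -> nat) D D' :
  D' `<=` D -> coherent f g D -> coherent f g D'.
Proof. by move=> s [C [c cP]]; exists C, c => x y /s Dx /s Dy; exact: cP. Qed.

Lemma coherent_comp K K' (f g : K -> nat) (h : K' -> K) D D' :
  (forall x, D' x -> D (h x)) -> coherent f g D -> coherent (f \o h) (g \o h) D'.
Proof. by move=> s [C [c cP]]; exists C, (c \o h) => x y /s Dx /s Dy; exact: cP. Qed.

Lemma coherent_setU K (f g : K -> nat) D D' :
  coherent f g D -> coherent f g D' -> coherent f g (D `|` D').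
Proof.
move=> [C [c cP]] [C' [c' cP']].
exists (C + C')%type, (fun x => if pselect (D x) then inl (c x) else inr (c' x)).
move=> x y; case: pselect; case: pselect => // nDy Dx Ux Uy [cxy].
  by apply: cP.
by apply: cP'; [case: Ux| case: Uy |].
Qed.

Lemma coherent_bigcup K (f g : K -> nat) (D : nat -> set K) n :
  (forall i, i < n -> coherent f g (D i)) -> coherent f g (\bigcup_(i < n) D i).
Proof.
elim: n => [|n IH] H.
  by exists unit, (fun=> tt) => x y [i]; rewrite /= ltn0.
apply: (@coherent_sub _ _ _ ((\bigcup_(i < n) D i) `|` D n)).
  move=> x [i /=]; rewrite ltnS leq_eqVlt => /orP[/eqP->|lin] Dx; first by right.
  by left; exists i.
by apply: coherent_setU; [apply: IH => i lin; apply: H; exact: ltnW|exact: H].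
Qed.

Lemma coherent_finite K (f g : K -> nat) D : finite_set D -> coherent f g D.
Proof.
move=> fD; have /countable_inj_on[h hD] := finite_set_countable fD.
have [n nP] := finite_bounded h fD.
exists 'I_n.+1, (fun x => inord (h x)) => x y Dx Dy /(congr1 val) /=.
rewrite !inordK ?ltnS; [|exact/ltnW/nP|exact/ltnW/nP].
by move=> /hD -> //; rewrite !ltnn.
Qed.

(** A pairing that is increasing in [b]: tagging values by [a] preserves their order within one
    tag. *)
Definition pair_code (a b : nat) := 2 ^ a * b.*2.+1.

Lemma pair_code_inj a b a' b' : pair_code a b = pair_code a' b' -> a = a' /\ b = b'.
Proof.
rewrite /pair_code => e.
have logE c d : logn 2 (2 ^ c * d.*2.+1) = c.
  rewrite lognM ?expn_gt0 // pfactorK // logn_coprime ?addn0 //.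
  by rewrite coprime2n /= odd_double.
have aa' : a = a' by rewrite -(logE a b) e logE.
split=> //; move/eqP: e; rewrite aa' eqn_pmul2l ?expn_gt0 // => /eqP[].
exact: double_inj.
Qed.

Lemma pair_code_lt a b b' : (pair_code a b < pair_code a b') = (b < b').
Proof. by rewrite /pair_code ltn_pmul2l ?expn_gt0 // ltnS ltn_double. Qed.

(** Each point is tagged with the first [E k] containing it and keeps its value under [psi k]. Only
    the tags up to [n] occur on [E n], which gives finitely many pieces, and on each of them [psi k]
    is coherent with [psi n]. *)
Lemma coherent_amalgamation K (X : set K) (E : nat -> set K) (psi : nat -> K -> nat) :
  countable X -> (forall n, inj_on (E n) (psi n)) ->
  (forall m n, coherent (psi m) (psi n) (E m `&` E n)) ->
  exists phi, inj_on X phi /\ forall n, coherent phi (psi n) (X `&` E n).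
Proof.
move=> /countable_inj_on[theta thX] psiI psiC.
(* [d x] is one more than the first index of a set containing [x], and 0 if there is none. *)
have /choice[d dP] (x : K) : exists o, if o is n.+1 then E n x /\ forall m, E m x -> n <= m
    else forall m, ~ E m x.
  have [exE|N] := pselect (exists n, `[<E n x>]); last first.
    by exists 0 => m Em; apply: N; exists m; apply/asboolP.
  exists (ex_minn exE).+1; case: ex_minnP => n /asboolP En nmin; split=> // m Em.
  by apply: nmin; apply/asboolP.
pose phi x := if d x is n.+1 then pair_code n.+1 (psi n x) else pair_code 0 (theta x).
exists phi; split=> [x y Xx Xy|n].
  rewrite /phi; have := dP x; have := dP y.
  case: (d x) => [|m]; case: (d y) => [|n] dy dx /pair_code_inj[//].
    by move=> _; exact: thX.
  by move=> [mn]; rewrite mn in dx *; apply: psiI; [case: dx|case: dy].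
apply: (@coherent_sub _ _ _ (\bigcup_(k < n.+1) [set x | d x = k.+1 /\ E n x])).
  move=> x [Xx Ex]; have := dP x; case dx : (d x) => [|k] kP; first by case: (kP n).
  by exists k => //=; rewrite ltnS; apply: (proj2 kP).
apply: coherent_bigcup => k _; apply: (@coherent_trans _ _ (psi k)).
  exists unit, (fun=> tt) => x y [dx _] [dy _] _.
  by rewrite /phi dx dy pair_code_lt.
apply: coherent_sub (psiC k n) => x [dx Ex]; split=> //.
by have := dP x; rewrite dx => -[].
Qed.

Lemma wFN_coherent_family (K : Type) (Rc : set nat -> set nat -> Prop) (nu : set nat -> K) :
  ctbl_wo Rc -> wFN K -> exists phi : set K -> K -> nat,
  (forall X, ctinf X -> inj_on X (phi X)) /\
  forall X Y, ctinf X -> ctinf Y -> coherent (phi X) (phi Y) (X `&` Y).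
Proof.
move=> woc [F [FP Fint]].
have [|lt [N [swo Nlt cN Nsub NF]]] := wFN_order_exists nu woc (F := F).
  by move=> p /FP[].
have [wf tr tot] := swo.
pose Q X (f : set K -> K -> nat) (u : K -> nat) := ctinf X -> inj_on X u /\
  forall Y, lt Y X -> ctinf Y -> coherent u (f Y) (X `&` Y).
have [||phi phiP] := @wf_construct _ _ lt Q (inhabits (fun=> 0)) wf.
- move=> X f g u fg H /H[uI uC]; split=> // Y YX cY.
  by rewrite -fg //; exact: uC.
- move=> X f IH.
  have [cX|ncX] := pselect (ctinf X); last by exists (fun=> 0).
  have coh Y Z : ctinf Y -> ctinf Z -> lt Y X -> lt Z X -> coherent (f Y) (f Z) (Y `&` Z).
    move=> cY cZ YX ZX; have [->|/tot[YZ|ZY]] := pselect (Y = Z).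
    + exact: coherent_eq.
    + by rewrite setIC; apply: coherent_sym; case: (IH _ ZX cZ) => _; exact.
    + by case: (IH _ YX cY) => _; exact.
  (* Coherence with these countably many sets suffices; every other earlier set is reached through
     an interpolant. *)
  pose C := [set B | [/\ F X B, N X B & B `<=` X]] `|`
            [set Y | (lt Y X /\ ~ N X Y) /\ ctinf Y].
  have cC : countable C.
    apply: setU_countable.
      by apply: subset_countable (proj2 (FP _ cX)) => B [].
    by apply: subset_countable (cN X) => Y [].
  have [E [EC CE]] := countable_enum_set0 cC.
  have CP B : C B -> ctinf B /\ lt B X.
    case=> [[FB /Nlt BX _]|[[? _] ?]] //; split=> //.
    exact: (proj1 (FP _ cX)).
  have [||phi [phiI phiC]] := @coherent_amalgamation _ X E (f \o E) (proj1 cX).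
  + move=> n; case: (EC n) => [/CP[cE EX]|->]; last by move=> x y [].
    by case: (IH _ EX cE).
  + move=> m n; case: (EC m) => [/CP[cm mX]|->]; last first.
      by rewrite set0I; apply: coherent_finite; exact: finite_set0.
    case: (EC n) => [/CP[cn nX]|->]; last first.
      by rewrite setI0; apply: coherent_finite; exact: finite_set0.
    exact: coh.
  exists phi => _; split=> // Y YX cY.
  have [NY|nNY] := pselect (N X Y); last first.
    have [n _ En] : range E Y by apply: CE; right.
    by rewrite -En; exact: phiC.
  have [fin|inf] := pselect (finite_set (X `&` Y)); first exact: coherent_finite.
  have cXY : ctinf (X `&` Y) by apply: ctinf_sub (proj1 cX) inf; exact: subIsetl.
  have NXY : N X (X `&` Y) by apply: (Nsub _ _ _ cY NY); exact: subIsetr.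
  have [r [Fr1 Fr2 sub1 sub2]] : exists r, [/\ F (X `&` Y) r, F X r, X `&` Y `<=` r & r `<=` X].
    by apply: Fint => //; exact: subIsetl.
  have Nr : N X r by exact: (NF _ _ _ cXY NXY).
  have cr : ctinf r by apply: (proj1 (FP _ cX)).
  have [n _ En] : range E r by apply: CE; left.
  (* The interpolant [r] contains the whole intersection, and both comparisons with [f r] are
     available. *)
  apply: (@coherent_trans _ _ (f r)).
    have := phiC n; rewrite /= En; apply: coherent_sub => x xXY.
    by split; [case: xXY|exact: sub1].
  apply: coherent_sub (coh _ _ cr cY (Nlt _ _ Nr) YX) => x xXY.
  by split; [exact: sub1|case: xXY].
exists phi; split=> [X cX|X Y cX cY]; first by case: (phiP X cX).
have [->|/tot[XY|YX]] := pselect (X = Y).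
- exact: coherent_eq.
- by rewrite setIC; apply: coherent_sym; case: (phiP _ cY) => _; exact.
- by case: (phiP _ cX) => _; exact.
Qed.

(** * Increasing enumerations and block reversal *)

Lemma increasing_enum T (X : set T) (f : T -> nat) : infinite_set X -> inj_on X f ->
  exists e : nat -> T, [/\ forall n, X (e n), forall m n, (f (e m) < f (e n)) = (m < n) &
    forall x, X x -> exists n, e n = x].
Proof.
move=> iX fX.
have minE n : exists x, [/\ X x, n <= f x & forall y, X y -> n <= f y -> f x <= f y].
  have [x Xx nx] := infinite_unbounded n iX fX.
  have exE : exists m, `[<exists y, [/\ X y, n <= f y & f y = m]>].
    by exists (f x); apply/asboolP; exists x.
  case: (ex_minnP exE) => m /asboolP[y [Xy ny ym]] mmin; exists y; split=> // z Xz nz.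
  by rewrite ym; apply: mmin; apply/asboolP; exists z.
have /choice[next nextP] := minE.
pose e n := iter n (fun x => next (f x).+1) (next 0).
have Xe n : X (e n) by case: n => [|n]; [case: (nextP 0)|case: (nextP (f (e n)).+1)].
have eS n : f (e n) < f (e n.+1) by case: (nextP (f (e n)).+1).
have emono := @homo_ltn _ (f \o e) (fun m n => m < n) (fun y x z => @ltn_trans y x z) eS.
have elt := leqW_mono (leq_mono emono).
exists e; split=> // x Xx; apply: contrapT => N.
(* A point never listed would bound all the values, although these grow at least like [n]. *)
have le n : f (e n) <= f x.
  elim: n => [|n IH]; first by case: (nextP 0) => _ _; exact.
  have [_ _] := nextP (f (e n)).+1; apply=> //; rewrite ltn_neqAle IH andbT.
  by apply/eqP => /(fX _ _ (Xe n) Xx) enx; apply: N; exists n.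
have ge n : n <= f (e n) by elim: n => // n IH; exact: leq_ltn_trans (eS n).
by have := leq_trans (ge (f x).+1) (le _); rewrite ltnn.
Qed.

(* Reverses each block [2^k - 1, 2^(k+1) - 1). *)
Definition block_rev (m : nat) := 3 * 2 ^ trunc_log 2 m.+1 - m.+2.

(** The reversed block is shifted up by one, onto [[2^k, 2^(k+1))]; the images of different blocks
    remain disjoint. *)
Lemma block_rev_bounds m k : 2 ^ k <= m.+1 < 2 ^ k.+1 ->
  block_rev m = 3 * 2 ^ k - m.+2 /\ 2 ^ k <= block_rev m < 2 ^ k.+1.
Proof.
move=> mk; have kE : trunc_log 2 m.+1 = k by apply: trunc_log_eq.
by rewrite /block_rev kE; move: mk; rewrite expnS; lia.
Qed.

Lemma block_rev_inj : injective block_rev.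
Proof.
move=> m n mn; have /block_rev_bounds[mE mB] := trunc_log_bounds (isT : 1 < 2) (ltn0Sn m).
have /block_rev_bounds[nE nB] := trunc_log_bounds (isT : 1 < 2) (ltn0Sn n).
have e : trunc_log 2 m.+1 = trunc_log 2 n.+1.
  by rewrite -(trunc_log_eq (isT : 1 < 2) mB) -(trunc_log_eq (isT : 1 < 2) nB) mn.
have m_lt := trunc_log_ltn m.+1 (isT : 1 < 2).
have n_lt := trunc_log_ltn n.+1 (isT : 1 < 2).
move: m_lt n_lt mE nE; rewrite mn e !expnS; lia.
Qed.

(** For [k] colours, the block of length [2^k > k] contains two points of the same colour, and
    reversal swaps their order. *)
Lemma block_rev_incoherent : ~ coherent id block_rev [set: nat].
Proof.
move=> [C [c cP]]; set k := #|C|; have kC : k < 2 ^ k by exact: ltn_expl.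
pose m (j : 'I_k.+1) := (2 ^ k).-1 + j.
have mB j : 2 ^ k <= (m j).+1 < 2 ^ k.+1.
  by rewrite /m expnS; have := ltn_ord j; lia.
have : ~ injective (c \o m).
  by move=> /leq_card; rewrite card_ord ltnn.
apply => i j /= cij; apply/val_inj/eqP; rewrite eqn_leq.
have le i' j' : c (m i') = c (m j') -> (i' <= j')%N.
  move=> e; rewrite leqNgt; apply/negP => ji; have := cP _ _ I I (esym e).
  have [-> _] := block_rev_bounds (mB i'); have [-> _] := block_rev_bounds (mB j').
  have := mB i'; have := mB j'; rewrite /m expnS /=; have := ltn_ord i'; lia.
by rewrite !le.
Qed.

Lemma ctinf_image T U (g : T -> U) X : inj_on X g -> ctinf X -> ctinf (g @` X).
Proof.
move=> gI [cX iX]; split; first exact: image_countable.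
by rewrite (eq_finite_set (inj_card_eq (proj1 (inj_onP _ _) gI))).
Qed.

(** * The group of permutations preserving a coherent family *)

Section CoherentGroup.
Variables (K : Type) (phi : set K -> K -> nat).
Hypothesis phiI : forall X, ctinf X -> inj_on X (phi X).
Hypothesis phiC : forall X Y, ctinf X -> ctinf Y -> coherent (phi X) (phi Y) (X `&` Y).

Definition coherent_group : set (K -> K) := [set g | bijective g /\
  forall X, ctinf X -> coherent (phi X) (phi (g @` X) \o g) X].

Lemma bij_ctinf (g : K -> K) X : bijective g -> ctinf X -> ctinf (g @` X).
Proof. by move=> /bij_inj gI; apply: ctinf_image => x y _ _; exact: gI. Qed.

Lemma coherent_group_group : perm_group coherent_group.
Proof.
split.
- by move=> g [].
- split; first by exists id.
  by move=> X _; rewrite image_id; exact: coherent_eq.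
- move=> g h [bg gP] [bh hP]; split; first exact: bij_comp.
  move=> X cX; apply: coherent_trans (hP _ cX) _.
  rewrite -image_comp.
  apply: (@coherent_comp _ _ (phi (h @` X)) (phi (g @` (h @` X)) \o g) h (h @` X)).
    by move=> x Xx; exists x.
  by apply: gP; exact: bij_ctinf.
- move=> g [bg gP]; have [h gh hg] := bg; exists h => //; split; first by exists g.
  move=> X cX; have bh : bijective h by exists g.
  have := gP _ (bij_ctinf bh cX).
  have -> : g @` (h @` X) = X.
    by rewrite image_comp (_ : g \o h = id) ?image_id //; apply/funext.
  move=> /coherent_sym /(coherent_comp (h := h) (D' := X)) H.
  have /H : forall x, X x -> (h @` X) (h x) by move=> x Xx; exists x.
  by apply: coherent_trans; apply: coherent_eq => x _ /=; rewrite hg.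
Qed.

(** Block reversal is transported to [X] along its [phi X]-increasing enumeration. A group element
    extending it maps [X] into itself, so [phi X] and [phi X \o g] would be coherent on [X]; pulled
    back to the naturals, this contradicts incoherence of block reversal. *)
Lemma coherent_group_not_transitive (X : set K) : ctinf X -> ~ omega_transitive coherent_group.
Proof.
move=> cX tr; have [e [Xe elt esurj]] := increasing_enum (proj2 cX) (phiI cX).
have eI m n : e m = e n -> m = n.
  move=> emn; have := elt m n; have := elt n m; rewrite emn ltnn.
  by case: (ltngtP m n).
have /choice[idx idxP] (x : K) : exists n, X x -> e n = x.
  by have [/esurj[n <-]|N] := pselect (X x); [exists n|exists 0].
have [||g [bg gP] gE] := tr X (e \o block_rev \o idx).
- apply/(inj_onP X) => x y Xx Xy /= /eI/block_rev_inj xy.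
  by rewrite -(idxP _ Xx) -(idxP _ Xy) xy.
- have -> : X `|` (e \o block_rev \o idx) @` X = X; last by [].
  by apply/seteqP; split=> [x [//|[y _ <-]]|x Xx]; [exact: Xe|left].
have gXX : g @` X `<=` X by move=> _ [x Xx <-]; rewrite gE //; exact: Xe.
have coh : coherent (phi X) (phi X \o g) X.
  apply: coherent_trans (gP _ cX) _.
  apply: (@coherent_comp _ _ (phi (g @` X)) (phi X) g (g @` X `&` X)).
    by move=> x Xx; split; [exists x|apply: gXX; exists x].
  by apply: phiC => //; exact: bij_ctinf.
apply: block_rev_incoherent.
have := coherent_comp (h := e) (D' := setT) (fun n _ => Xe n) coh.
move=> [C [c cP]]; exists C, c => m n _ _ /(cP _ _ I I) /=.
rewrite !gE //= !elt; congr (_ = (_ < _)); congr block_rev; apply: eI; exact: idxP.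
Qed.

(** Enlarge [X] and [Y] to a countable [Z] in which both have infinite complement. The permutation
    sends [X] to [Y] and [Z] minus [X] to [Z] minus [Y], preserving the order given by [phi Z], and
    fixes every point outside [Z]. *)
Lemma coherent_group_homogeneous : ~ countable [set: K] -> omega_homogeneous coherent_group.
Proof.
move=> ncK X Y cX cY.
have cXY : countable (X `|` Y) by apply: setU_countable; [case: cX|case: cY].
have [D cD DN] := infinite_ctinf_sub (uncountable_infinite (uncountable_setD ncK cXY)).
pose Z := X `|` Y `|` D.
have cZ : ctinf Z.
  split; first by apply: setU_countable => //; case: cD.
  by apply: sub_infinite_set (proj2 cD) => x; right.
have XZ : X `<=` Z by move=> x; left; left.
have YZ : Y `<=` Z by move=> x; left; right.
have iZX : infinite_set (Z `\` X).
  apply: sub_infinite_set (proj2 cD) => x Dx; split; first by right.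
  by move=> Xx; have [_] := DN _ Dx; apply; left.
have iZY : infinite_set (Z `\` Y).
  apply: sub_infinite_set (proj2 cD) => x Dx; split; first by right.
  by move=> Xx; have [_] := DN _ Dx; apply; right.
have /choice[e eP] (W : set K) : exists e : nat -> K, W `<=` Z -> infinite_set W ->
    [/\ forall n, W (e n), forall m n, (phi Z (e m) < phi Z (e n)) = (m < n) &
    forall x, W x -> exists n, e n = x].
  have [[WZ iW]|N] := pselect (W `<=` Z /\ infinite_set W); last first.
    by have [x _] := infinite_setN0 (proj2 cX); exists (fun=> x) => WZ iW; case: N.
  have [|e eP] := @increasing_enum _ W (phi Z) iW; last by exists e.
  by move=> x y /WZ Zx /WZ Zy; exact: phiI.
have /choice[idx idxP] (Wx : set K * K) : exists n, Wx.1 `<=` Z -> infinite_set Wx.1 ->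
    Wx.1 Wx.2 -> e Wx.1 n = Wx.2.
  have [[WZ iW Wx']|N] := pselect ([/\ Wx.1 `<=` Z, infinite_set Wx.1 & Wx.1 Wx.2]).
    by have [_ _ /(_ _ Wx')[n <-]] := eP _ WZ iW; exists n.
  by exists 0 => *; case: N.
have eI W n : W `<=` Z -> infinite_set W -> idx (W, e W n) = n.
  move=> WZ iW; have [We elt _] := eP _ WZ iW; have /= E := idxP (W, e W n) WZ iW (We n).
  have := elt (idx (W, e W n)) n; have := elt n (idx (W, e W n)).
  by rewrite E ltnn; case: ltngtP.
(* Both sets are kept as parameters because exchanging them gives the inverse. *)
pose g X Y x := if pselect (X x) then e Y (idx (X, x))
  else if pselect (Z x) then e (Z `\` Y) (idx (Z `\` X, x)) else x.
have ZD W : Z `\` W `<=` Z by move=> x [].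
have gX A B x : A x -> g A B x = e B (idx (A, x)) by rewrite /g; case: pselect.
have gZ A B x : (Z `\` A) x -> g A B x = e (Z `\` B) (idx (Z `\` A, x)).
  by move=> [Zx nAx]; rewrite /g; case: pselect => // ?; case: pselect.
have gN A B x : A `<=` Z -> ~ Z x -> g A B x = x.
  by move=> AZ nZ; rewrite /g; case: pselect => [/AZ//|?]; case: pselect.
have gK A B : A `<=` Z -> B `<=` Z -> infinite_set A -> infinite_set B ->
    infinite_set (Z `\` A) -> infinite_set (Z `\` B) -> cancel (g A B) (g B A).
  move=> AZ BZ iA iB iZA iZB x; have [Ax|nAx] := pselect (A x).
    rewrite (gX A B) // gX; last by case: (eP B BZ iB).
    by rewrite eI //; exact: (idxP (A, x) AZ iA Ax).
  have [Zx|nZx] := pselect (Z x); last by rewrite !gN.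
  rewrite (gZ A B) // gZ; last by case: (eP _ (ZD B) iZB).
  by rewrite eI; [exact: (idxP (Z `\` A, x) (ZD A) iZA (conj Zx nAx))|exact: ZD|].
have [iX iY] := (proj2 cX, proj2 cY).
have bg : bijective (g X Y) by exists (g Y X); exact: gK.
have gmono A B x y : A `<=` Z -> B `<=` Z -> infinite_set A -> infinite_set B -> A x -> A y ->
  (phi Z x < phi Z y) = (phi Z (e B (idx (A, x))) < phi Z (e B (idx (A, y)))).
  move=> AZ BZ iA iB Ax Ay.
  have [_ eA _] := eP A AZ iA; have [_ eB _] := eP B BZ iB.
  have /= Ex := idxP (A, x) AZ iA Ax; have /= Ey := idxP (A, y) AZ iA Ay.
  by rewrite eB -[RHS]eA Ex Ey.
exists (g X Y); last first.
  apply/seteqP; split=> [_ [x Xx <-]|y Yy].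
    by rewrite gX //; case: (eP Y YZ iY).
  exists (g Y X y); last exact: gK.
  by rewrite gX //; case: (eP X XZ iX).
split=> // W cW; have cgW := bij_ctinf bg cW.
have coh A : A `<=` Z -> (forall x, A x -> Z (g X Y x)) ->
   (forall x y, A x -> A y -> (phi Z x < phi Z y) = (phi Z (g X Y x) < phi Z (g X Y y))) ->
   coherent (phi W) (phi (g X Y @` W) \o g X Y) (W `&` A).
  move=> AZ gAZ gA; apply: (@coherent_trans _ _ (phi Z)).
    by apply: coherent_sub (phiC cW cZ) => x [Wx /AZ].
  apply: (@coherent_trans _ _ (phi Z \o g X Y)).
    by exists unit, (fun=> tt) => x y [_ Ax] [_ Ay] _; exact: gA.
  apply: coherent_comp (phiC cZ cgW) => x [Wx Ax]; split; first exact: gAZ.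
  by exists x.
(* Three pieces: on the two inside [Z] the comparison goes through [phi Z]; outside [Z] the map is
   the identity and the coherence of the family applies directly. *)
apply: (@coherent_sub _ _ _ ((W `&` X) `|` (W `&` (Z `\` X)) `|` (W `\` Z))).
  move=> x Wx; have [Zx|nZx] := pselect (Z x); last by right.
  by left; have [Xx|nXx] := pselect (X x); [left|right].
apply: coherent_setU; first apply: coherent_setU.
- apply: coh => // [x Xx|x y Xx Xy].
    by apply: (YZ); rewrite gX //; case: (eP Y YZ iY).
  by rewrite !gX //; exact: gmono.
- apply: coh => // [x Xx|x y Xx Xy].
    by apply: (ZD Y); rewrite gZ //; case: (eP _ (ZD Y) iZY).
  by rewrite !gZ //; apply: gmono.
apply: (@coherent_trans _ _ (phi (g X Y @` W))).
  apply: coherent_sub (phiC cW cgW) => x [Wx nZx]; split=> //.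
  by exists x => //; rewrite gN.
by apply: coherent_eq => x [_ nZx] /=; rewrite gN.
Qed.

End CoherentGroup.

Lemma wFN_HnT (K : Type) (Rc : set nat -> set nat -> Prop) (nu : set nat -> K) :
  ctbl_wo Rc -> ~ countable [set: K] -> wFN K -> HnT K.
Proof.
move=> woc ncK /(wFN_coherent_family nu woc)[phi [phiI phiC]].
have [X cX _] := infinite_ctinf_sub (uncountable_infinite ncK).
exists (coherent_group phi); split.
- exact: coherent_group_group.
- exact: coherent_group_homogeneous.
- exact: coherent_group_not_transitive cX.
Qed.

(** * SPL implies CLS *)

Lemma countable_sub_range T (A : set T) (x0 : T) : countable A ->
  exists e : nat -> T, A `<=` range e.
Proof.
move=> cA; have [||e eA] := @countable_enum _ (x0 |` A).
- by apply: setU_countable => //; exact: countable1.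
- by exists x0; left.
by exists e; rewrite -eA => x Ax; right.
Qed.

(** * Closures and countable compactness *)

Section Topology.
Variables (T : Type) (op : set (set T)).
Hypothesis top : is_topology op.

Lemma open_bigcup I (D : set I) (U : I -> set T) :
  (forall i, D i -> op (U i)) -> op (\bigcup_(i in D) U i).
Proof.
move=> DU; rewrite -(bigcup_image D U id).
by have [_ _ _ opU] := top; apply: opU => _ [i Di <-]; exact: DU.
Qed.

Lemma open_bigcap_lt (U : nat -> set T) n :
  (forall i, op (U i)) -> op (\bigcap_(i < n) U i).
Proof.
move=> opU; have [_ opT opI _] := top; elim: n => [|n IH].
  by rewrite (_ : \bigcap_(i < 0) U i = setT) //; apply/seteqP; split=> // x _ i.
have -> : \bigcap_(i < n.+1) U i = (\bigcap_(i < n) U i) `&` U n; last exact: opI.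
apply/seteqP; split=> [x H|x [H Un] i /=].
  by split=> [i /= lin|]; apply: H => //=; exact: ltnW.
by rewrite ltnS leq_eqVlt => /orP[/eqP->//|]; exact: H.
Qed.

Lemma sub_closure Y : Y `<=` closure op Y.
Proof. by move=> x Yx U _ Ux; exists x. Qed.

Lemma closed_closure Y : closed op (closure op Y).
Proof.
rewrite /closed.
have -> : ~` closure op Y = \bigcup_(U in [set U | op U /\ U `&` Y = set0]) U.
  apply/seteqP; split=> [x|x [U [opU UY] Ux] cx]; last first.
    by have := cx U opU Ux; rewrite UY => -[].
  move=> /existsNP[U /not_implyP[opU /not_implyP[Ux UY]]]; exists U => //.
  by split=> //; apply: contrapT => /eqP/set0P.
by apply: open_bigcup => U [].
Qed.

Lemma closureS Y Y' : Y `<=` Y' -> closure op Y `<=` closure op Y'.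
Proof.
move=> YY' x cx U opU Ux; have [y [Uy Yy]] := cx U opU Ux.
by exists y; split=> //; exact: YY'.
Qed.

Lemma closedU C D : closed op C -> closed op D -> closed op (C `|` D).
Proof. by rewrite /closed setCU; have [_ _ opI _] := top; exact: opI. Qed.

Lemma closedI C D : closed op C -> closed op D -> closed op (C `&` D).
Proof.
rewrite /closed setCI => cC cD; rewrite -bigcup2E.
by apply: open_bigcup => -[|[|i]] _ //=; case: top.
Qed.

Lemma countably_compact_cover (C : set T) (O : nat -> set T) :
  countably_compact op -> closed op C -> (forall n, op (O n)) ->
  C `<=` \bigcup_n O n -> exists n, C `<=` \bigcup_(i < n) O i.
Proof.
move=> cc clC opO CO.
have [|_ [[n _ <-]//|->]//||G [fG GF Gcov]] := cc (range O `|` [set ~` C]).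
- by apply: setU_countable; [apply: image_countable; exact: countableP|exact: countable1].
- apply/seteqP; split=> // x _; have [Cx|nCx] := pselect (C x).
    by have [n _ Ox] := CO _ Cx; exists (O n) => //; left; exists n.
  by exists (~` C) => //; right.
have /choice[j jP] (U : set T) : exists n, range O U -> O n = U.
  by have [[n _ <-]|N] := pselect (range O U); [exists n|exists 0].
have [n nP] := finite_bounded j fG.
exists n => x Cx; have [U GU Ux] : (\bigcup_(U in G) U) x by rewrite Gcov.
have [/jP OU|UC] := GF _ GU; last by rewrite UC in Ux.
by exists (j U); [exact: nP|rewrite OU].
Qed.
End Topology.

(** * Countable clopen sets in splendid spaces *)

Section Splendid.
Variables (T : Type) (op : set (set T)).
Hypothesis spl : splendid op.
Hypothesis infT : infinite_set [set: T].

Let top : is_topology op. Proof. by case: spl => -[]. Qed.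
Let cc : countably_compact op. Proof. by case: spl. Qed.
Let op0 : op set0. Proof. by case: top. Qed.
Let opT : op setT. Proof. by case: top. Qed.

Lemma closed_point x : closed op [set x].
Proof.
have [[_ [T1 _]] _ _ _] := spl; rewrite /closed.
have -> : ~` [set x] = \bigcup_(U in [set U | op U /\ ~ U x]) U.
  apply/seteqP; split=> [y /= /T1[U [opU [Uy nUx]]]|y [U [_ nUx] Uy] yx].
    by exists U.
  by rewrite yx in Uy.
by apply: open_bigcup => // U [].
Qed.

Lemma countable_closure Y : countable Y -> countable (closure op Y).
Proof.
(* Fairness speaks of infinite sets only, so [Y] is padded by [D]. *)
move=> cY; have [D cD _] := infinite_ctinf_sub infT; have [_ _ _ fair] := spl.
have [|+ _] := fair (Y `|` D).
  split; first by apply: setU_countable => //; case: cD.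
  by apply: sub_infinite_set (proj2 cD) => x; right.
by apply: subset_countable; apply: closureS => x; left.
Qed.

(** Regularity separates each point of [E] from [F]. As [E] is countable and closed, finitely many
    of the neighbourhoods cover it, and the matching neighbourhoods of [F] may be intersected. *)
Lemma separate_closed E F : closed op E -> closed op F -> countable E -> E `&` F = set0 ->
  exists U V, [/\ op U, op V, E `<=` U, F `<=` V & U `&` V = set0].
Proof.
move=> clE clF cE EF; have [x0 _] := infinite_setN0 infT.
have [e Ee] := countable_sub_range x0 cE; have [[_ [_ reg]] _ _ _] := spl.
have /choice[UV UVP] (n : nat) : exists UV : set T * set T,
    [/\ op UV.1, op UV.2, F `<=` UV.2, UV.1 `&` UV.2 = set0 & E (e n) -> UV.1 (e n)].
  have [Een|N] := pselect (E (e n)); last first.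
    (* Neutral values for the union and the intersection at indices that enumerate no point of
       [E]. *)
    by exists (set0, setT); split=> //=; rewrite set0I.
  have nF : ~ F (e n) by move=> Fen; have : (E `&` F) (e n) by []; rewrite EF.
  by have [U [V [opU opV Ux FV UV0]]] := reg F (e n) clF nF; exists (U, V).
have [||n EU] := @countably_compact_cover _ op E (fun n => (UV n).1) cc clE.
- by move=> n; case: (UVP n).
- move=> x Ex; have [n _ en] := Ee _ Ex; exists n => //.
  by rewrite -en in Ex *; case: (UVP n) => _ _ _ _; exact.
exists (\bigcup_(i < n) (UV i).1), (\bigcap_(i < n) (UV i).2); split=> //.
- by apply: open_bigcup => // i _; case: (UVP i).
- by apply: open_bigcap_lt => // i; case: (UVP i).
- by move=> x Fx i _; case: (UVP i) => _ _ + _ _; exact.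
- apply/seteqP; split=> // x [[i lin Ux] Vx].
  have : ((UV i).1 `&` (UV i).2) x by split=> //; exact: Vx.
  by case: (UVP i) => _ _ _ ->.
Qed.

Lemma countable_open_nbhd C : countable C -> closed op C ->
  exists W, [/\ op W, countable W & C `<=` W].
Proof.
move=> cC clC; have [x0 _] := infinite_setN0 infT; have [_ _ lc _] := spl.
have /choice[W WP] := lc; exists (\bigcup_(x in C) W x); split.
- by apply: open_bigcup => // x _; case: (WP x).
- by apply: bigcup_countable => // x _; case: (WP x).
- by move=> x Cx; exists x => //; case: (WP x).
Qed.

(* Points are put one at a time into one of two growing disjoint closed sets, each being
   interior to the next; the unions are then complementary open sets. *)
Lemma countable_clopen_nbhd C : countable C -> closed op C ->
  exists D, [/\ op D, closed op D, countable D & C `<=` D].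
Proof.
move=> cC clC; have [W [opW cW CW]] := countable_open_nbhd cC clC.
(* The second component always contains the complement of [W], which keeps the first inside [W] and
   hence countable. *)
pose P (EF : set T * set T) := [/\ closed op EF.1, closed op EF.2,
  EF.1 `&` EF.2 = set0, ~` W `<=` EF.2 & C `<=` EF.1].
pose S (EF EF' : set T * set T) := exists U V, [/\ op U, op V, EF.1 `<=` U /\ U `<=` EF'.1
  & EF.2 `<=` V /\ V `<=` EF'.2].
have /choice[st stP] (EFx : (set T * set T) * T) : exists EF', P EFx.1 ->
    [/\ P EF', S EFx.1 EF' & EF'.1 EFx.2 \/ EF'.2 EFx.2].
  case: EFx => -[E F] x /=.
  have [[/= clE clF EF WF CE]|N] := pselect (P (E, F)); last by exists (set0, set0).
  have subW A : A `&` F = set0 -> A `<=` W.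
    move=> AF y Ay; apply: contrapT => /WF Fy.
    by have : (A `&` F) y by []; rewrite AF.
  have cE : countable E by apply: subset_countable cW; exact: subW.
  have [U [V [opU opV EU FV UV]]] := separate_closed clE clF cE EF.
  (* [E1] is a closed neighbourhood of [E] missing [F]; a second separation gives a closed
     neighbourhood [F1] of [F] missing [E1]. *)
  pose E1 := ~` V; have clE1 : closed op E1 by rewrite /closed setCK.
  have E1F : E1 `&` F = set0 by apply/seteqP; split=> // y [nV /FV].
  have cE1 : countable E1 by apply: subset_countable cW; exact: subW.
  have UE1 : U `<=` E1 by move=> y Uy Vy; have : (U `&` V) y by []; rewrite UV.
  have [U1 [V1 [opU1 opV1 EU1 FV1 UV1]]] := separate_closed clE1 clF cE1 E1F.
  pose F1 := ~` U1; have clF1 : closed op F1 by rewrite /closed setCK.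
  have EF1 : E1 `&` F1 = set0 by apply/seteqP; split=> // y [/EU1].
  have VF1 : V1 `<=` F1 by move=> y Vy Uy; have : (U1 `&` V1) y by []; rewrite UV1.
  have CE1 : C `<=` E1 by move=> y /CE/EU/UE1.
  have WF1 : ~` W `<=` F1 by move=> y /WF/FV1/VF1.
  have [E1x|nE1x] := pselect (E1 x).
    by exists (E1, F1) => _; split; [split|exists U, V1; split|left].
  exists (E1, F1 `|` [set x]) => _; split; [split=> //=|exists U, V1; split=> //|by right; right].
  - by apply: closedU => //; exact: closed_point.
  - by rewrite setIUr EF1 set0U; apply/seteqP; split=> // y [Ey /= yx]; apply: nE1x; rewrite -yx.
  - by move=> y /WF1; left.
  - by split=> // y /VF1; left.
have [x0 _] := infinite_setN0 infT; have [e We] := countable_sub_range x0 cW.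
pose s := fix s n := if n is m.+1 then st (s m, e m) else (C, ~` W).
have Ps n : P (s n).
  elim: n => [|n IH]; last by have [] := stP (s n, e n) IH.
  split=> //=; first by rewrite /closed setCK.
  by apply/seteqP; split=> // x [/CW].
have Ss n : S (s n) (s n.+1) by have [] := stP (s n, e n) (Ps n).
have mono1 m n : m <= n -> (s m).1 `<=` (s n).1.
  elim: n => [|n IH]; first by rewrite leqn0 => /eqP->.
  rewrite leq_eqVlt => /orP[/eqP-> //|/IH sub x /sub].
  by have [U [V [_ _ [EU UE] _]]] := Ss n => /EU/UE.
have mono2 m n : m <= n -> (s m).2 `<=` (s n).2.
  elim: n => [|n IH]; first by rewrite leqn0 => /eqP->.
  rewrite leq_eqVlt => /orP[/eqP-> //|/IH sub x /sub].
  by have [U [V [_ _ _ [FV VF]]]] := Ss n => /FV/VF.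
have /choice[UV UVP] := Ss; have /choice[V VP] := UVP.
pose D := \bigcup_n (s n).1.
have DU : D = \bigcup_n UV n.
  apply/seteqP; split=> x [n _ xn].
    by exists n => //; case: (VP n) => _ _ [+ _] _; exact.
  by exists n.+1 => //; case: (VP n) => _ _ [_ +] _; exact.
have DV : ~` D = \bigcup_n V n.
  apply/seteqP; split=> [x nDx|x [n _ Vx] [m _ Ex]]; last first.
    have Fx : (s n.+1).2 x by case: (VP n) => _ _ _ [_]; exact.
    have [_ _ EF _ _] := Ps (maxn m n.+1).
    have : ((s (maxn m n.+1)).1 `&` (s (maxn m n.+1)).2) x.
      by split; [exact: mono1 (leq_maxl _ _) _ Ex|exact: mono2 (leq_maxr _ _) _ Fx].
    by rewrite EF.
  have [n Fx] : exists n, (s n).2 x.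
    have [Wx|nWx] := pselect (W x); last by exists 0.
    have [n _ en] := We _ Wx; move: nDx; rewrite -en => nDx.
    have [_ _ [Ex|Fx]] := stP (s n, e n) (Ps n); last by exists n.+1.
    by case: nDx; exists n.+1.
  by exists n => //; case: (VP n) => _ _ _ [+ _]; exact.
exists D; split.
- by rewrite DU; apply: open_bigcup => // n _; case: (VP n).
- by rewrite /closed DV; apply: open_bigcup => // n _; case: (VP n).
- apply: subset_countable cW => x [n _ Ex]; apply: contrapT => nWx.
  have [_ _ EF WF _] := Ps n; have : ((s n).1 `&` (s n).2) x by split=> //; exact: WF.
  by rewrite EF.
- by move=> x Cx; exists 0.
Qed.

(* By compactness a relatively clopen subset of [C] is a finite union of finite
   intersections of members of a fixed countable family of separating open sets. *)
Lemma countable_clopen_traces C : countable C -> closed op C ->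
  countable [set C `&` D | D in [set D | op D /\ closed op D]].
Proof.
move=> cC clC; have [x0 _] := infinite_setN0 infT.
have [e Ce] := countable_sub_range x0 cC.
have /choice[UV UVP] (ij : nat * nat) : exists UV : set T * set T,
    e ij.1 <> e ij.2 -> [/\ op UV.1, op UV.2, UV.1 (e ij.1), UV.2 (e ij.2) & UV.1 `&` UV.2 = set0].
  have [[_ [_ reg]] _ _ _] := spl.
  have [eq|neq] := pselect (e ij.1 = e ij.2); first by exists (set0, set0).
  have [U [V [opU opV Ux yV UV0]]] := reg _ _ (@closed_point (e ij.2)) neq.
  by exists (U, V) => _; split=> //; exact: yV.
pose basic (it : nat * seq nat) : set T := [set y | forall j, j \in it.2 -> (UV (it.1, j)).1 y].
pose h (l : seq (nat * seq nat)) : set T := [set y | C y /\ exists2 it, it \in l & basic it y].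
apply: (@subset_countable _ _ (range h)); last by apply: image_countable; exact: countableP.
move=> _ [D [opD clD] <-].
have inter i : C (e i) -> D (e i) -> exists t : seq nat,
    [/\ op (basic (i, t)), basic (i, t) (e i) & C `&` basic (i, t) `<=` D].
  (* The part of [C] outside [D] is covered by finitely many neighbourhoods of bad points.
     Intersecting the matching neighbourhoods of [e i] gives a basic set whose trace on [C] lies in
     [D]. *)
  move=> Ci Di; pose bad j := C (e j) /\ ~ D (e j).
  have neq j : bad j -> e i <> e j by move=> [_ nDj] ij; rewrite ij in Di.
  pose O j := if pselect (bad j) then (UV (i, j)).2 else set0.
  have [|||n CO] := @countably_compact_cover _ op (C `&` ~` D) O cc.
  - by apply: closedI => //; rewrite /closed setCK.
  - by move=> j; rewrite /O; case: pselect => // bj; have [] := UVP (i, j) (neq _ bj).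
  - move=> x [Cx nDx]; have [j _ ej] := Ce _ Cx; exists j => //.
    rewrite -ej in Cx nDx *; rewrite /O; case: pselect => [bj|[]]; last by split.
    by have [] := UVP (i, j) (neq _ bj).
  exists [seq j <- iota 0 n | `[<bad j>]]; split.
  - have -> : basic (i, [seq j <- iota 0 n | `[<bad j>]]) =
        \bigcap_(j < n) (if pselect (bad j) then (UV (i, j)).1 else setT).
      apply/seteqP; split=> y H j /=.
        move=> lin; case: pselect => // bj; apply: H => /=.
        by rewrite mem_filter mem_iota add0n leq0n lin !andbT; apply/asboolP.
      rewrite mem_filter mem_iota => /andP[/asboolP bj] /= lin.
      by have := H j lin; case: pselect.
    apply: open_bigcap_lt => // j; case: pselect => // bj.
    by have [] := UVP (i, j) (neq _ bj).
  - move=> j /=; rewrite mem_filter => /andP[/asboolP bj _].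
    by have [] := UVP (i, j) (neq _ bj).
  - move=> y [Cy By]; apply: contrapT => nDy.
    have [|j /= ljn] := CO y; first by [].
    rewrite /O; case: pselect => // bj Vy.
    have [_ _ _ _ E0] := UVP (i, j) (neq _ bj).
    have : ((UV (i, j)).1 `&` (UV (i, j)).2) y.
      split=> //; apply: By => /=.
      by rewrite mem_filter mem_iota add0n leq0n ljn !andbT; apply/asboolP.
    by rewrite E0.
have /choice[t tP] (i : nat) : exists t, C (e i) -> D (e i) ->
    [/\ op (basic (i, t)), basic (i, t) (e i) & C `&` basic (i, t) `<=` D].
  have [[Ci Di]|N] := pselect (C (e i) /\ D (e i)).
    by have [t tP] := inter i Ci Di; exists t.
  by exists [::] => Ci Di; case: N.
pose good i := C (e i) /\ D (e i).
(* Compactness again: finitely many of these basic sets cover [C] meet [D], and their list is the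
   code. *)
have [|||n CO] := @countably_compact_cover _ op (C `&` D)
    (fun i => if pselect (good i) then basic (i, t i) else set0) cc.
- exact: closedI.
- by move=> i; case: pselect => // -[Ci Di]; case: (tP i Ci Di).
- move=> x [Cx Dx]; have [i _ ei] := Ce _ Cx; exists i => //.
  rewrite -ei in Cx Dx *; case: pselect => [[Ci Di]|[]]; last by split.
  by case: (tP i Ci Di).
exists [seq (i, t i) | i <- iota 0 n & `[<good i>]] => //.
apply/seteqP; split=> y.
  move=> [Cy [_ /mapP[i + ->] By]]; rewrite mem_filter => /andP[/asboolP[Ci Di] _].
  by split=> //; have [_ _] := tP i Ci Di; apply.
move=> [Cy Dy]; split=> //; have [//|i /= lin] := CO y.
case: pselect => // gi By; exists (i, t i) => //.
apply: map_f; rewrite mem_filter mem_iota add0n leq0n lin !andbT; exact/asboolP.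
Qed.
End Splendid.

(** The countable clopen sets are pulled back along an injection [io] of [K]. The trace on [Y] of
    such a preimage depends only on the trace of the clopen set on the closure of the image of [Y],
    a countable closed set. *)
Lemma SPL_CLS (K : Type) : infinite_set [set: K] -> SPL K -> CLS K.
Proof.
move=> iK [X [op [spl [[KX _] _]]]].
have infX : infinite_set [set: X].
  by move=> fX; apply: iK; exact: card_le_finite KX fX.
have [io [ioI _]] := inj_into KX (infinite_setN0 infX).
have top : is_topology op by case: spl => -[].
exists [set A | ctinf A /\ exists D, [/\ op D, closed op D & A = io @^-1` D]]; split.
- by move=> A [].
- move=> Y cY; have cC := countable_closure spl infX (image_countable io (proj1 cY)).
  have [D [opD clD cD CD]] := countable_clopen_nbhd spl infX cC (closed_closure top _).
  have YD : Y `<=` io @^-1` D by move=> k Yk; apply/CD/sub_closure; exists k.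
  exists (io @^-1` D) => //; split; last by exists D.
  split; last by apply: sub_infinite_set YD (proj2 cY).
  by apply: (@inj_on_countable _ _ _ D io) => // k l _ _; exact: ioI.
- move=> Y cY; set C := closure op (io @` Y).
  have cC : countable C := countable_closure spl infX (image_countable io (proj1 cY)).
  have cT := countable_clopen_traces spl infX cC (closed_closure top _).
  apply: subset_countable (image_countable (fun D => Y `&` io @^-1` D) cT).
  move=> _ [_ [_ [D [opD clD ->]]] <-]; exists (C `&` D); first by exists D.
  apply/seteqP; split=> k [Yk]; first by case.
  by split=> //; split=> //; apply: sub_closure; exists k.
Qed.

Unset Implicit Arguments.
Theorem theorem9 (K : Type) :
  GCH -> is_aleph_omega K ->
  [/\ SPL K -> CLS K,
      CLS K -> wFN K,
      wFN K -> SAT K,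
      wFN K -> Nt K
    & wFN K -> HnT K].
Proof.
move=> /CH_order[R woR] /aleph_omega_uncountable ncK.
have [nu nuI] := CH_inj_uncountable woR ncK.
split.
- exact: SPL_CLS (uncountable_infinite ncK).
- exact: CLS_wFN woR.
- exact: wFN_SAT nu woR.
- exact: wFN_Nt nuI ncK.
- exact: wFN_HnT nu woR ncK.
Qed.
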